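(* Let $c$ be a radial cost, let $F$ satisfy $F(1)=0$, let $\mu\in\mathcal M_+(\Omega)$ with $\mu\ll\mathcal L$, and let $M\in\mathbb N$. The unbalanced quantization problem $$\min\Big\{W(\mu,\nu)\ \Big|\ \nu=\sum_{i=1}^M m_i\delta_{x_i},\ x_1,\dots,x_M\in\Omega,\ m_1,\dots,m_M\ge0\Big\}\qquad(\mathrm{Q})$$ is equivalent to the minimization problem $$\min\{J(x_1,\dots,x_M)\mid x_1,\dots,x_M\in\Omega\},\qquad J(x_1,\dots,x_M)=\sum_{i=1}^M\int_{V_i(x_1,\dots,x_M)}-F^*(-c(x,x_i))\,\mathrm d\mu(x),\qquad(\mathrm{T})$$ where $V_i(x_1,\dots,x_M)=\{x\in\Omega\mid d(x,x_i)\le d(x,x_j)\text{ for }j=1,\dots,M\}$ is the Voronoi cell associated with $x_i$ and where one adopts the conventions $-F^*(-\infty)=F(0)$ and $\partial F^*(-\infty)=\{0\}$. Indeed, the minimum values of (Q) and (T) coincide and, if $(x_1,\dots,x_M)$ minimizes (T) and the minimal value is finite, then $(x_1,\dots,x_M,m_1,\dots,m_M)$ minimizes (Q) for $$m_i=\int_{V_i(x_1,\dots,x_M)}\partial F^*(-c(x,x_i))\,\mathrm d\mu(x),\qquad i=1,\dots,M$$ (the subgradient $\partial F^*(-c(x,x_i))$ contains a unique element for $\mu$-almost every $x$, so the $m_i$ are well defined). Furthermore, the optimal transport plan $\gamma$ associated with $W(\mu,\nu)$ only transports mass from each Voronoi cell $V_i(x_1,\dots,x_M)$ to the corresponding point 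$x_i$.
   Context: $\Omega=\overline U\subset\mathbb R^d$ with $U$ open; $d(\cdot,\cdot)$ is the Euclidean distance; $\mathcal L$ is the $d$-dimensional Lebesgue measure; $\mathcal M_+(X)$ is the set of finite nonnegative Radon measures on $X$; $\pi_1,\pi_2:\Omega\times\Omega\to\Omega$ are the coordinate projections and $T_\#\mu$ denotes pushforward; $\partial$ denotes the convex subdifferential. Marginal discrepancy: $F:[0,\infty)\to[0,\infty]$ is proper, convex, lower semi-continuous with $\lim_{s\to\infty}F(s)/s=\infty$. For $\rho,\mu\in\mathcal M_+(\Omega)$ set $\mathcal F(\rho|\mu)=\int_\Omega F\big(\tfrac{\mathrm d\rho}{\mathrm d\mu}\big)\,\mathrm d\mu$ if $\rho\ll\mu$ and $\mathcal F(\rho|\mu)=+\infty$ otherwise. $F$ is extended by $F(s)=\infty$ for $s<0$, and $F^*(z)=\sup_{s\ge0}(z s-F(s))$, $z\in\mathbb R$. Cost: $c:\Omega\times\Omega\to[0,\infty]$ is lower semi-continuous. It is called radial if $c(x,y)=\ell(d(x,y))$ for a nondecreasing function $\ell:[0,\infty)\to[0,\infty]$ with $\ell(0)=0$ that is strictly increasing and continuous on its domain $\{\ell<\infty\}$. Unbalanced transport: $W(\mu,\nu)=\inf\{\mathcal E(\gamma)\mid\gamma\in\mathcal M_+(\Omega\times\Omega)\}$, where $\mathcal E(\gamma)=\int_{\Omega\times\Omega}c\,\mathrm d\gamma+\mathcal F(\pi_{1\#}\gamma|\mu)+\mathcal F(\pi_{2\#}\gamma|\nu)$; an optimal transport plan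 associated with $W(\mu,\nu)$ is a minimizer $\gamma$. *)

(* Defs.v *)
From HB Require Import structures.
From mathcomp Require Import all_boot all_order all_algebra.
From mathcomp Require Import all_classical all_reals all_analysis.

Set Implicit Arguments.
Unset Strict Implicit.
Unset Printing Implicit Defensive.

Import Order.TTheory GRing.Theory Num.Theory.
Import numFieldNormedType.Exports.

Local Open Scope classical_set_scope.
Local Open Scope ring_scope.

Definition rV_borel_display : measure_display.
Proof. exact: default_measure_display. Qed.

Section rV_borel.
Variables (R : realType) (d : nat).

Let borel_set0 : <<s @open 'rV[R]_d >> set0.
Proof. exact: sigma_algebra0. Qed.

Let borel_setC (A : set 'rV[R]_d) :
  <<s @open 'rV[R]_d >> A -> <<s @open 'rV[R]_d >> (~` A).
Proof. exact: sigma_algebraC. Qed.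

Let borel_bigcup (A : (set 'rV[R]_d)^nat) :
  (forall i, <<s @open 'rV[R]_d >> (A i)) ->
  <<s @open 'rV[R]_d >> (\bigcup_i A i).
Proof. exact: sigma_algebra_bigcup. Qed.

HB.instance Definition _ := @isMeasurable.Build rV_borel_display
  'rV[R]_d <<s @open 'rV[R]_d >> borel_set0 borel_setC borel_bigcup.

End rV_borel.

Fixpoint rV_lebesgue (R : realType) (d : nat) : set 'rV[R]_d -> \bar R :=
  match d with
  | 0 => dirac (0 : 'rV[R]_0)
  | d'.+1 => pushforward (lebesgue_measure \x @rV_lebesgue R d')%E
      (fun p : R * 'rV[R]_d' => row_mx p.1%:M p.2 : 'rV[R]_(1 + d'))
  end.

(* The topology of 'rV[R]_d comes from the sup norm, hence an explicit
   Euclidean distance. *)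
Definition edist (R : realType) (d : nat) (x y : 'rV[R]_d) : R :=
  Num.sqrt (\sum_(i < d) (x 0 i - y 0 i) ^+ 2).

Definition is_minimizer (R : realType) (X : Type) (A : set X)
    (f : X -> \bar R) (x : X) : Prop :=
  A x /\ (forall y, A y -> (f x <= f y)%E).

Section entropy.
Variable R : realType.
Implicit Types (F G : R -> \bar R) (z : \bar R).
Local Open Scope ereal_scope.

(* F : [0, +oo[ -> [0, +oo] is represented by its extension by +oo to the
   negative reals. *)
Record is_entropy F : Prop := {
  entropy_neg : forall s : R, (s < 0)%R -> F s = +oo;
  entropy_ge0 : forall s : R, 0 <= F s;
  entropy_proper : exists s : R, F s < +oo;
  entropy_convex : forall s t a : R, (0 <= a <= 1)%R ->
    F (a * s + (1 - a) * t)%R <= a%:E * F s + (1 - a)%:E * F t;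
  entropy_lsc : lower_semicontinuous F;
  entropy_superlinear : F s * (s^-1)%:E @[s --> +oo%R] --> +oo
}.

Definition conjugate F (w : R) : \bar R :=
  ereal_sup [set (w * s)%:E - F s | s in [set s : R | (0 <= s)%R]].

Definition subdifferential G (w : R) : set R :=
  [set p | forall v : R, G w + (p * (v - w))%:E <= G v].

(* Extension of conjugate F and of its subdifferential to -oo by the
   conventions - F^*(-oo) = F(0) and dF^*(-oo) = {0}. The argument is always
   minus a nonnegative cost, so the values at +oo are irrelevant. *)
Definition conjugateE F z : \bar R :=
  match z with
  | w%:E => conjugate F w
  | -oo => - F 0%R
  | +oo => +oo
  end.

Definition subdiff_conjugateE F z : set R :=
  match z with
  | w%:E => subdifferential (conjugate F) w
  | -oo => [set 0%R]
  | +oo => set0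
  end.

(* Some element of the subdifferential: the only one when it is a singleton. *)
Definition subgrad_conjugateE F z : R := xget 0%R (subdiff_conjugateE F z).

End entropy.

Section marginals.
Context d1 d2 (T1 : measurableType d1) (T2 : measurableType d2).
Variables (R : realType) (g : {finite_measure set (T1 * T2)%type -> \bar R}).
Local Open Scope ereal_scope.

Definition marginal1 : set T1 -> \bar R := pushforward g fst.
Definition marginal2 : set T2 -> \bar R := pushforward g snd.

Let marginal1_0 : marginal1 set0 = 0.
Proof. exact: measure0. Qed.

Let marginal1_ge0 A : 0 <= marginal1 A.
Proof. exact: measure_ge0. Qed.

Let marginal1_sigma_additive : semi_sigma_additive marginal1.
Proof. exact: measure_semi_sigma_additive. Qed.

HB.instance Definition _ := isMeasure.Build _ _ _ marginal1
  marginal1_0 marginal1_ge0 marginal1_sigma_additive.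

Let marginal2_0 : marginal2 set0 = 0.
Proof. exact: measure0. Qed.

Let marginal2_ge0 A : 0 <= marginal2 A.
Proof. exact: measure_ge0. Qed.

Let marginal2_sigma_additive : semi_sigma_additive marginal2.
Proof. exact: measure_semi_sigma_additive. Qed.

HB.instance Definition _ := isMeasure.Build _ _ _ marginal2
  marginal2_0 marginal2_ge0 marginal2_sigma_additive.

Let marginal1_fin : fin_num_fun marginal1.
Proof.
move=> A mA; apply: fin_num_measure.
by rewrite -[X in measurable X]setTI; exact: measurable_fst.
Qed.

Let marginal2_fin : fin_num_fun marginal2.
Proof.
move=> A mA; apply: fin_num_measure.
by rewrite -[X in measurable X]setTI; exact: measurable_snd.
Qed.

HB.instance Definition _ := Measure_isFinite.Build _ _ _ marginal1 marginal1_fin.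
HB.instance Definition _ := Measure_isFinite.Build _ _ _ marginal2 marginal2_fin.

End marginals.

Section discrete_measure.
Context d (T : measurableType d) (R : realType) (M : nat).
Variables (x : 'I_M -> T) (m : 'I_M -> {nonneg R}).
Local Open Scope ereal_scope.

Definition discrete_measure (A : set T) : \bar R :=
  \sum_(i < M) (m i)%:num%:E * \d_(x i) A.

Let s (k : nat) : {measure set T -> \bar R} :=
  if insub k is Some i then mscale (m i) (\d_(x i)) else mzero.

Let discrete_measureE : discrete_measure = msum s M.
Proof. by apply/funext => A; apply: eq_bigr => i _; rewrite /s valK. Qed.

Let discrete0 : discrete_measure set0 = 0.
Proof. by rewrite discrete_measureE measure0. Qed.

Let discrete_ge0 A : 0 <= discrete_measure A.
Proof. by rewrite discrete_measureE measure_ge0. Qed.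

Let discrete_sigma_additive : semi_sigma_additive discrete_measure.
Proof. by rewrite discrete_measureE; exact: measure_semi_sigma_additive. Qed.

HB.instance Definition _ := isMeasure.Build _ _ _ discrete_measure
  discrete0 discrete_ge0 discrete_sigma_additive.

Let discrete_fin : fin_num_fun discrete_measure.
Proof.
by move=> A mA; apply/sum_fin_numP => i _ _; rewrite fin_numM ?fin_num_measure.
Qed.

HB.instance Definition _ :=
  Measure_isFinite.Build _ _ _ discrete_measure discrete_fin.

End discrete_measure.

(* Finite nonnegative Radon measures on a closed set Omega of R^d are
   represented by the finite Borel measures on R^d that vanish outside Omega;
   every finite Borel measure on R^d is Radon. Likewise on Omega * Omega. *)
Section unbalanced_transport.
Variables (R : realType) (d : nat).
Variables (F : R -> \bar R) (c : 'rV[R]_d -> 'rV[R]_d -> \bar R).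
Variable Omega : set 'rV[R]_d.
Local Open Scope ereal_scope.

Definition discrepancy (rho mu : {finite_measure set 'rV[R]_d -> \bar R}) :
    \bar R :=
  if `[< rho `<< mu >]
  then \int[mu]_(y in Omega)
         F (fine (Radon_Nikodym (charge_of_finite_measure rho) mu y))
  else +oo.

Definition transport_plan :
    set {finite_measure set ('rV[R]_d * 'rV[R]_d)%type -> \bar R} :=
  [set g | g (~` (Omega `*` Omega)) = 0].

Definition transport_energy (mu nu : {finite_measure set 'rV[R]_d -> \bar R})
    (g : {finite_measure set ('rV[R]_d * 'rV[R]_d)%type -> \bar R}) : \bar R :=
  \int[g]_(p in Omega `*` Omega) c p.1 p.2 +
  discrepancy (marginal1 g) mu + discrepancy (marginal2 g) nu.

Definition unbalanced_cost (mu nu : {finite_measure set 'rV[R]_d -> \bar R}) :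
    \bar R :=
  ereal_inf [set transport_energy mu nu g | g in transport_plan].

Definition optimal_plan (mu nu : {finite_measure set 'rV[R]_d -> \bar R}) :
    set {finite_measure set ('rV[R]_d * 'rV[R]_d)%type -> \bar R} :=
  [set g | is_minimizer transport_plan (transport_energy mu nu) g].

End unbalanced_transport.

(* The values of c outside Omega * Omega and of l on the negative reals are
   irrelevant. *)
Section radial_cost.
Variables (R : realType) (d : nat).
Variables (Omega : set 'rV[R]_d) (c : 'rV[R]_d -> 'rV[R]_d -> \bar R).
Local Open Scope ereal_scope.

Definition is_cost : Prop :=
  (forall x y, Omega x -> Omega y -> 0 <= c x y) /\
  lower_semicontinuous
    ((fun p => c p.1 p.2) : subspace (Omega `*` Omega) -> \bar R).

Record is_radial_profile (l : R -> \bar R) : Prop := {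
  radial_ge0 : forall r : R, (0 <= r)%R -> 0 <= l r;
  radial_at0 : l 0%R = 0;
  radial_nondecreasing : forall r s : R, (0 <= r <= s)%R -> l r <= l s;
  radial_increasing : forall r s : R, (0 <= r < s)%R -> l s < +oo -> l r < l s;
  radial_continuous :
    {within [set r : R | (0 <= r)%R /\ l r < +oo], continuous l}
}.

Definition is_radial : Prop :=
  exists2 l, is_radial_profile l &
    forall x y, Omega x -> Omega y -> c x y = l (edist x y).

End radial_cost.

Section quantization.
Variables (R : realType) (d M : nat).
Variables (F : R -> \bar R) (c : 'rV[R]_d -> 'rV[R]_d -> \bar R).
Variables (Omega : set 'rV[R]_d).
Variable mu : {finite_measure set 'rV[R]_d -> \bar R}.
Implicit Type x : 'I_M -> 'rV[R]_d.
Local Open Scope ereal_scope.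

Definition voronoi x (i : 'I_M) : set 'rV[R]_d :=
  [set y | Omega y /\ forall j, (edist y (x i) <= edist y (x j))%R].

Definition in_domain : set ('I_M -> 'rV[R]_d) :=
  [set x | forall i, Omega (x i)].

Definition quantizer : set (('I_M -> 'rV[R]_d) * ('I_M -> {nonneg R})) :=
  [set q | in_domain q.1].

Definition quantization_cost (q : ('I_M -> 'rV[R]_d) * ('I_M -> {nonneg R})) :
    \bar R :=
  unbalanced_cost F c Omega mu (discrete_measure q.1 q.2).

Definition tessellation_cost x : \bar R :=
  \sum_(i < M) \int[mu]_(y in voronoi x i) - conjugateE F (- c y (x i)).

Definition tessellation_mass x (i : 'I_M) : \bar R :=
  \int[mu]_(y in voronoi x i) (subgrad_conjugateE F (- c y (x i)))%:E.

End quantization.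

(* Main.v *)
Require Import Defs.
From HB Require Import structures.
From mathcomp Require Import all_boot all_order all_algebra.
From mathcomp Require Import all_classical all_reals all_analysis.
From mathcomp Require Import measurable_realfun ring lra.

(** Everything is a function of the distance r(y) from y to the nearest site.
    With K(r) = - F^*(- l(r)) and S(r) a subgradient of F^* at - l(r), Young's
    inequality l(r) s + F(s) >= K(r), applied to the density s of the first
    marginal, bounds every transport energy below by E = int K(r(y)) dmu: a plan
    of finite energy charges only Omega x {x_1, ..., x_M}, where c(y, x_i) >=
    l(r(y)). The plan sending the mass S(r(y)) dmu(y) from y to its nearest site
    attains E, because S(r) is almost everywhere the maximizer in the conjugate:
    F^* has countably many kinks and spheres are mu-null. Finally E <= J, with
    equality for distinct sites since bisectors are mu-null. A configuration with
    repeated sites counts overlapping cells several times in J, but it can be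
    replaced by a distinct one of no larger E; and for a minimizer of J the
    overlaps carry no cost, hence K = 0 and S = 0 there. *)

Set Implicit Arguments.
Unset Strict Implicit.
Unset Printing Implicit Defensive.

Import Order.TTheory GRing.Theory Num.Theory.
Import numFieldNormedType.Exports.
Local Open Scope classical_set_scope.
Local Open Scope ring_scope.

(* MathComp-Analysis has an edist of its own. *)
Local Notation edist := Defs.edist.

(** * The conjugate entropy *)

Section conjugate_theory.
Variables (R : realType) (F : R -> \bar R).
Hypothesis hF : is_entropy F.
Local Open Scope ereal_scope.

Lemma entropy_fin_num {s : R} : F s < +oo -> F s \is a fin_num.
Proof. by move=> Fs; rewrite ge0_fin_numE//; exact: entropy_ge0. Qed.

Lemma conjugate_ge (w : R) {s : R} : (0 <= s)%R ->
  (w * s)%:E - F s <= conjugate F w.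
Proof. by move=> s0; apply: ereal_sup_ubound; exists s. Qed.

(** Superlinear growth confines the maximization to a compact interval [[0, B]], on which lower
    semicontinuity yields a maximizer. *)
Lemma conjugate_attained (w : R) : exists s : R,
  [/\ (0 <= s)%R, F s \is a fin_num & conjugate F w = (w * s)%:E - F s].
Proof.
have [s0 Fs0] := entropy_proper hF.
have s00 : (0 <= s0)%R.
  by rewrite leNgt; apply/negP => /(entropy_neg hF) E; rewrite E ltxx in Fs0.
have f0 := entropy_fin_num Fs0.
pose C := (w * s0 - fine (F s0))%R.
have /cvgey_ge/(_ (w + 1)%R) [K [_ hK]] := entropy_superlinear hF.
(* For [s > B] one has [F s >= (w + 1) s], so [w s - F s <= - s], and [s > - C] bounds this by [C],
   the value of the objective at [s0]. *)
pose B := Num.max 0%R (Num.max s0 (Num.max K (- C))%R).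
have hB s : (B < s)%R -> (w * s)%:E - F s <= C%:E.
  rewrite !gt_max => /andP[sgt0 /andP[_ /andP[/hK/= FK CB]]].
  move: FK (entropy_ge0 hF s); case: (F s) => [r| |]//= FK _; last by rewrite leNye.
  by move: FK; rewrite -EFinM lee_fin ler_pdivlMr// => FK; rewrite lee_fin; nra.
have s0B : (s0 <= B)%R by rewrite !le_max lexx !orbT.
have B0 : (0 <= B)%R by rewrite le_max lexx.
have C_le : C%:E <= conjugate F w.
  by rewrite /C EFinD EFinN fineK//; exact: conjugate_ge.
have conj_lty : conjugate F w < +oo.
  apply: (@le_lt_trans _ _ (`|w| * B + `|C|)%:E); last exact: ltry.
  apply: ge_ereal_sup => _ [s /= sge0 <-].
  have [/hB h|sB] := ltP B s.
    apply: (le_trans h); rewrite lee_fin (le_trans (ler_norm _))// lerDr.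
    by rewrite mulr_ge0.
  have := entropy_ge0 hF s; case: (F s) => [r| |]//=; last by rewrite leNye.
  rewrite !lee_fin => r0.
  have wsB : (w * s <= `|w| * B)%R.
    by rewrite (le_trans (ler_wpM2r sge0 (ler_norm w)))// ler_wpM2l.
  have := normr_ge0 C; lra.
have conj_fin : conjugate F w \is a fin_num.
  by rewrite fin_numElt conj_lty andbT (lt_le_trans _ C_le)// ltNyr.
(* Without a maximizer every [s >= 0] misses the supremum strictly; compactness of [[0, B]] makes
   the gap uniform, which contradicts the definition of the supremum. *)
apply: contrapT => noatt.
have lt_conj s : (0 <= s)%R -> (w * s)%:E - F s < conjugate F w.
  move=> sge0; rewrite lt_neqAle conjugate_ge// andbT; apply/eqP => E.
  apply: noatt; exists s; split=> //.
  apply: entropy_fin_num; rewrite ltey; apply/eqP => Fs.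
  by move: conj_fin; rewrite -E Fs addeNy.
pose v := fine (conjugate F w).
have vE : conjugate F w = v%:E by rewrite fineK.
have /compact_near_coveringP/(_ nat \oo
    (fun n x => (w * x)%:E - F x < (v - n.+1%:R^-1)%:E)) := @segment_compact R 0%R B.
case.
  move=> x /=; rewrite in_itv/= => /andP[x0 xB].
  (* Lower semicontinuity keeps [F y > b] near [x]. Of the excess [2 e] of [b] over [w x - v], one
     half absorbs the variation of [w y] and the other half the gap [n.+1%:R^-1]. *)
  have [b b1 b2] : exists2 b : R, (w * x - v < b)%R & b%:E < F x.
    have := lt_conj x x0; have := entropy_ge0 hF x.
    rewrite vE; case: (F x) => [r| |]//= _; last first.
      by move=> _; exists (w * x - v + 1)%R; [rewrite ltrDl ltr01|exact: ltry].
    rewrite -EFinD lte_fin => h; exists ((w * x - v + r) / 2)%R; first lra.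
    rewrite lte_fin; lra.
  have [V nV hV] := entropy_lsc hF b2.
  pose e := ((b - (w * x - v)) / 2)%R.
  have e0 : (0 < e)%R by rewrite /e; lra.
  have wc : {for x, continuous (fun y : R => w * y)%R}.
    by move=> ?; apply: cvgM; [exact: cvg_cst|exact: cvg_id].
  have hw : \forall y \near x, (w * y < w * x + e)%R.
    by move/cvgrPdist_lt : (wc) => /(_ e e0); apply: filterS => y /=;
      rewrite ltr_norml => /andP[+ _];
      rewrite ltrNl opprB ltrBlDl.
  exists ([set y | V y /\ (w * y < w * x + e)%R], [set n | (n.+1%:R^-1 < e)%R]).
    split=> /=; first exact: filterI.
    exact: (near_infty_natSinv_lt (PosNum e0)).
  move=> [y n] /= [[/hV + wy] ne].
  case: (F y) => [r| |]//=; last by rewrite addeNy ltNyr.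
  rewrite lte_fin -EFinD lte_fin => br; move: ne wy; rewrite /e.
  by move: n.+1%:R^-1%R => k; lra.
move=> N _ /(_ N (leqnn N)) hN.
have sN : (0 < N.+1%:R^-1 :> R)%R by rewrite invr_gt0 ltr0n.
suff : conjugate F w <= (v - N.+1%:R^-1)%:E.
  by rewrite vE lee_fin lerBrDr gerDl leNgt sN.
(* Since [s0] lies in [[0, B]], the uniform gap also holds for [C], hence for the bound beyond
   [B]. *)
have CN : C%:E < (v - N.+1%:R^-1)%:E.
  have := hN s0; rewrite /= in_itv/= s00 s0B => /(_ isT).
  by rewrite -(fineK f0) -EFinB.
apply: ge_ereal_sup => _ [s /= sge0 <-].
have [/hB h|sB] := ltP B s; first exact/ltW/(le_lt_trans h).
by apply/ltW/hN; rewrite /= in_itv/= sge0.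
Qed.

Lemma conjugate_fin_num (w : R) : conjugate F w \is a fin_num.
Proof.
by have [s [_ fs ->]] := conjugate_attained w; rewrite fin_numB fs.
Qed.

Lemma fenchel_young (w : R) {s : R} : (0 <= s)%R ->
  (w * s)%:E <= F s + conjugate F w.
Proof.
move=> s0; have := conjugate_ge w s0; have := conjugate_fin_num w.
have := entropy_ge0 hF s.
case: (F s) => [r| |]//=; case: (conjugate F w) => [t| |]//= _ _.
- by rewrite -EFinB !lee_fin => ?; lra.
- by move=> _; rewrite leey.
Qed.

(* The maximizer in the conjugate is a subgradient, so where the subdifferential
   is a singleton the Fenchel equality holds without appealing to F** = F. *)
Lemma subdifferential_fenchel (w : R) : exists2 s : R,
  subdifferential (conjugate F) w s & (w * s)%:E = F s + conjugate F w.
Proof.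
have [s [s0 fs E]] := conjugate_attained w; exists s; last first.
  by rewrite E addeC subeK.
move=> v /=; rewrite E; apply: le_trans (conjugate_ge v s0).
rewrite -(fineK fs) -!EFinB -EFinD lee_fin; lra.
Qed.

Lemma subdifferential_fine {w p : R} (v : R) : subdifferential (conjugate F) w p ->
  (fine (conjugate F w) + p * (v - w) <= fine (conjugate F v))%R.
Proof.
move=> /(_ v); rewrite -(fineK (conjugate_fin_num w)).
by rewrite -(fineK (conjugate_fin_num v)) -EFinD lee_fin.
Qed.

(** Add the subgradient inequality at [w] tested at [w'] to the one at [w'] tested at [w]. *)
Lemma subdifferential_le {w w' p p' : R} : (w < w')%R ->
  subdifferential (conjugate F) w p -> subdifferential (conjugate F) w' p' ->
  (p <= p')%R.
Proof.
move=> ww' /(subdifferential_fine w') h /(subdifferential_fine w) h'.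
have : ((p - p') * (w' - w) <= 0)%R by lra.
by rewrite pmulr_lle0 ?subr_gt0// subr_le0.
Qed.

Lemma conjugate_nondecreasing {v w : R} : (v <= w)%R ->
  conjugate F v <= conjugate F w.
Proof.
move=> vw; apply: ge_ereal_sup => _ [s /= s0 <-].
apply: le_trans (conjugate_ge w s0).
by rewrite leeD2r// lee_fin ler_wpM2r.
Qed.

(** F^* is nondecreasing, its supremum being over [s >= 0]; the subgradient inequality is tested at
    [w - 1]. *)
Lemma subdifferential_ge0 {w p : R} :
  subdifferential (conjugate F) w p -> (0 <= p)%R.
Proof.
move=> /(subdifferential_fine (w - 1)%R).
have := @conjugate_nondecreasing (w - 1)%R w.
rewrite -(fineK (conjugate_fin_num w)) -(fineK (conjugate_fin_num (w - 1)%R)).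
by rewrite lee_fin => /(_ _)/[!gerBl] /(_ ler01); lra.
Qed.

Lemma conjugate_le0 {w : R} : (w <= 0)%R -> conjugate F w <= 0.
Proof.
move=> w0; apply: ge_ereal_sup => _ [s /= s0 <-].
have : (w * s <= 0)%R by rewrite mulr_le0_ge0.
have := entropy_ge0 hF s; case: (F s) => [r| |]//= r0 ws.
by rewrite -EFinB lee_fin; move: r0; rewrite lee_fin; lra.
Qed.

(* If F* vanishes at w < 0 then the maximizer is s = 0 and F 0 = 0, so that F*
   vanishes on the whole negative half-line. *)
Lemma subdifferential_eq0 {w p : R} : (w < 0)%R -> conjugate F w = 0 ->
  subdifferential (conjugate F) w p -> p = 0%R.
Proof.
move=> w0 conj0 dp.
have [s [s0 fs]] := conjugate_attained w; rewrite conj0 => E.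
have F0 : F 0%R = 0.
  have := entropy_ge0 hF s; move: E; rewrite -(fineK fs) -EFinB => -[E].
  rewrite lee_fin => h.
  have s_eq0 : s = 0%R.
    apply/eqP; rewrite eq_le s0 andbT; have : (0 <= w * s)%R by lra.
    by rewrite nmulr_rge0.
  move: E fs; rewrite s_eq0 mulr0 sub0r => /esym/eqP; rewrite oppr_eq0 => /eqP + fs.
  by move=> E; rewrite -(fineK fs) E.
have conj_ge0 v : 0 <= conjugate F v.
  by have := conjugate_ge v (lexx (0%R : R)); rewrite F0 mulr0 sube0.
apply/eqP; rewrite eq_le (subdifferential_ge0 dp) andbT.
(* F^* also vanishes at [w / 2 > w], so the subgradient inequality there leaves
   [p (- w / 2) <= 0]. *)
have /(_ (w / 2)%R) := dp.
have -> : conjugate F (w / 2)%R = 0.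
  by apply/eqP; rewrite eq_le conj_ge0 andbT conjugate_le0//; lra.
rewrite conj0 add0e lee_fin; have -> : (w / 2 - w = - w / 2)%R by lra.
by rewrite pmulr_lle0//; lra.
Qed.

End conjugate_theory.

(** * Cost and mass as functions of the distance *)

Section radial_densities.
Variables (R : realType) (F : R -> \bar R) (l : R -> \bar R).
Hypotheses (hF : is_entropy F) (hl : is_radial_profile l).
Local Open Scope ereal_scope.

(* Cost and transported mass per unit of mu-mass at distance r from the nearest
   site. *)
Definition cost_density (r : R) : \bar R := - conjugateE F (- l r).
Definition mass_density (r : R) : R := subgrad_conjugateE F (- l r).

Variant profile_spec (r : R) : \bar R -> Prop :=
| ProfileFin (t : R) of (0 <= t)%R : profile_spec r t%:E
| ProfileInfty : profile_spec r +oo.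

Lemma profileP {r : R} : (0 <= r)%R -> profile_spec r (l r).
Proof.
move=> /(radial_ge0 hl); case: (l r) => [t| |]//; first by constructor.
by move=> _; constructor.
Qed.

(** At finite cost the maximizer in the conjugate is a subgradient, and at infinite cost the set is
    [{0}]: [xget] never resorts to its default value. *)
Lemma mass_densityP {r : R} : (0 <= r)%R ->
  subdiff_conjugateE F (- l r) (mass_density r).
Proof.
move=> r0; rewrite /mass_density /subgrad_conjugateE.
case: (profileP r0) => [t t0|]; last by case: xgetP => // /(_ 0%R) /(_ erefl).
case: xgetP => // h; have [s hs _] := subdifferential_fenchel hF (- t).
by have := h s hs.
Qed.

Lemma mass_density_ge0 {r : R} : (0 <= r)%R -> (0 <= mass_density r)%R.
Proof.
move=> r0; have := mass_densityP r0; case: (profileP r0) => [t _|].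
  exact: subdifferential_ge0.
by move=> ->.
Qed.

(** Strict growth of [l] yields distinct arguments of F^*, where subgradients are ordered whichever
    elements are chosen; at infinite cost the only element is 0, below every subgradient. *)
Lemma subdiff_profile_le {r s p q : R} : (0 <= r < s)%R ->
  subdiff_conjugateE F (- l r) p -> subdiff_conjugateE F (- l s) q -> (q <= p)%R.
Proof.
move=> rs; have /andP[r0 rs'] := rs.
have s0 : (0 <= s)%R by rewrite (le_trans r0)// ltW.
have := radial_increasing hl rs.
have := radial_nondecreasing hl (_ : (0 <= r <= s)%R).
rewrite r0 (ltW rs') => /(_ isT).
case: (profileP r0) => [t t0|]; case: (profileP s0) => [u u0|]//=.
- by rewrite ltry => _ /(_ isT); rewrite lte_fin => tu + h;
    apply: subdifferential_le h => //; rewrite ltrN2.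
- by move=> _ _ /subdifferential_ge0-/(_ hF) p0 ->.
- by move=> _ _ -> ->.
Qed.

Lemma mass_density_nonincreasing {r s : R} : (0 <= r <= s)%R ->
  (mass_density s <= mass_density r)%R.
Proof.
move=> /andP[r0]; rewrite le_eqVlt => /predU1P[->//|rs].
have s0 : (0 <= s)%R by rewrite (le_trans r0)// ltW.
apply: (subdiff_profile_le _ (mass_densityP r0) (mass_densityP s0)).
by rewrite r0.
Qed.

Lemma cost_density_ge0 {r : R} : (0 <= r)%R -> 0 <= cost_density r.
Proof.
move=> r0; rewrite /cost_density.
case: (profileP r0) => [t t0|]/=; last by rewrite oppeK; exact: entropy_ge0.
by rewrite oppe_ge0 conjugate_le0// oppr_le0.
Qed.

(** Young's inequality at [s = 0]. The value [F 0] taken at infinite cost is thus the largest one,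
    which keeps [cost_density] monotone. *)
Lemma conjugate_ge_F0 (w : R) : - conjugate F w <= F 0%R.
Proof.
have := fenchel_young hF w (lexx (0%R : R)); rewrite mulr0.
by rewrite -(fineK (conjugate_fin_num hF w)) -leeBlDr// sub0e.
Qed.

Lemma cost_density_nondecreasing {r s : R} : (0 <= r <= s)%R ->
  cost_density r <= cost_density s.
Proof.
move=> rs; have /andP[r0 rs'] := rs.
have s0 : (0 <= s)%R by rewrite (le_trans r0).
have := radial_nondecreasing hl rs; rewrite /cost_density.
case: (profileP r0) => [t t0|]; case: (profileP s0) => [u u0|]//=.
- by rewrite lee_fin => tu; rewrite leeN2 conjugate_nondecreasing// lerN2.
- by rewrite oppeK => _; exact: conjugate_ge_F0.
Qed.

(** Young's inequality where [l r] is finite. Where it is infinite, the right-hand side is [F 0] for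
    [s = 0], the product with zero being zero, and infinite for [s > 0]. *)
Lemma cost_density_le {r s : R} : (0 <= r)%R -> (0 <= s)%R ->
  cost_density r <= l r * s%:E + F s.
Proof.
move=> r0 s0; rewrite /cost_density; case: (profileP r0) => [t t0|]/=.
  have := fenchel_young hF (- t) s0.
  rewrite -(fineK (conjugate_fin_num hF (- t))) addeC -leeBlDl//.
  have := entropy_ge0 hF s; case: (F s) => [a| |]//= _.
    by rewrite -!EFinM -!EFinB !lee_fin; lra.
  by move=> _; rewrite leey.
rewrite oppeK; move: s0; rewrite le_eqVlt => /predU1P[<-|s0].
  by rewrite mule0 add0e.
rewrite gt0_mulye ?lte_fin// addye ?leey//.
by have := entropy_ge0 hF s; case: (F s).
Qed.

(** At finite cost the maximizer in the conjugate is a subgradient, so uniqueness identifies it with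
    [mass_density r] and Young's inequality is an equality. *)
Lemma cost_densityE {r : R} : (0 <= r)%R ->
  (exists! s, subdiff_conjugateE F (- l r) s) ->
  cost_density r = l r * (mass_density r)%:E + F (mass_density r).
Proof.
move=> r0 [s0 [_ us0]]; move: (us0 _ (mass_densityP r0)) => <-.
move: us0; rewrite /cost_density; case: (profileP r0) => [t t0|]/= us0.
  have [s ds] := subdifferential_fenchel hF (- t); rewrite -(us0 _ ds).
  rewrite -(fineK (conjugate_fin_num hF (- t))).
  have := entropy_ge0 hF s0; case: (F s0) => [a| |]//= _.
  rewrite -EFinM -!EFinD => -[E]; congr (_%:E); lra.
by rewrite (us0 0%R erefl) mule0 add0e oppeK.
Qed.

(** Strict growth gives [l r > 0], so at finite cost F^* vanishes at a negative argument and
    [subdifferential_eq0] applies. *)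
Lemma mass_density_eq0 {r : R} : (0 < r)%R -> cost_density r = 0 ->
  mass_density r = 0%R.
Proof.
move=> r0; have := mass_densityP (ltW r0); rewrite /cost_density.
have := @radial_increasing _ _ hl 0%R r; rewrite r0 lexx (radial_at0 hl) => /(_ isT).
case: (profileP (ltW r0)) => [t t0|]/=; last by move=> _ ->.
rewrite ltry => /(_ isT); rewrite lte_fin => tgt0 dm /eqP; rewrite oppe_eq0 => /eqP.
by move=> E; apply: subdifferential_eq0 dm => //; rewrite oppr_lt0.
Qed.

(** Two distinct subgradients enclose a rational. By [subdiff_profile_le] the gaps at different
    distances do not overlap, so this rational determines the distance. *)
Lemma multivalued_countable : countable
  [set r : R | (0 <= r)%R /\ ~ exists! s, subdiff_conjugateE F (- l r) s].
Proof.
set B := [set r | _].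
have pick r : exists q : rat, B r -> exists p1 p2 : R,
    [/\ subdiff_conjugateE F (- l r) p1, subdiff_conjugateE F (- l r) p2,
        (p1 < ratr q)%R & (ratr q < p2)%R].
  have [[r0 nuniq]|nB] := pselect (B r); last by exists 0%R.
  have [p [dp pm]] : exists p, subdiff_conjugateE F (- l r) p /\ p <> mass_density r.
    apply: contrapT => h; apply: nuniq; exists (mass_density r); split.
      exact: mass_densityP.
    by move=> p dp; apply: contrapT => pm; apply: h; exists p; split=> // /esym.
  have dm := mass_densityP r0.
  case: (ltgtP p (mass_density r)) pm => // pm _.
    have [q /itvP qpm] := rat_in_itvoo pm.
    by exists q => _; exists p, (mass_density r); rewrite !qpm.
  have [q /itvP qpm] := rat_in_itvoo pm.
  by exists q => _; exists (mass_density r), p; rewrite !qpm.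
have [q qP] := choice pick.
apply/countable_injP; exists (choice.pickle \o q) => r s.
rewrite !inE => Br Bs /(pcan_inj choice.pickleK) qrs.
have ltF u v : B u -> B v -> (u < v)%R -> q u = q v -> False.
  move=> Bu Bv uv quv.
  have [p1 [p2 [d1 _ lt1 _]]] := qP u Bu.
  have [p1' [p2' [_ d2 _ lt2]]] := qP v Bv.
  have := @subdiff_profile_le u v p1 p2' _ d1 d2.
  rewrite uv Bu.1 => /(_ isT); rewrite leNgt => /negP; apply.
  by apply: lt_trans lt1 _; rewrite quv.
by case: (ltgtP r s) => // rs; [case: (ltF r s)|case: (ltF s r)].
Qed.

End radial_densities.

(** * Spheres and bisectors are null *)

Section lebesgue_quadrics.
Variable R : realType.

Lemma integral_countable_support (g : R -> \bar R) (N : set R) :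
  countable N -> (forall t, ~ N t -> g t = 0%E) ->
  (\int[lebesgue_measure]_t g t = 0)%E.
Proof.
move=> cN g0.
have mcount (B : set R) : countable B -> measurable B.
  by apply: countable_measurable => t; exact: measurable_set1.
have -> : g = g \_ N.
  apply/funext => t; rewrite patchE; case: ifPn => //.
  by rewrite notin_setE => /g0.
rewrite -integral_mkcond; apply: null_set_integral.
- exact: mcount.
- move=> _ Y _; apply: mcount.
  by apply: sub_countable cN; apply: subset_card_le => ? [].
- exact: countable_lebesgue_measure0.
Qed.

(** [rV_lebesgue] is a plain set function here, hence an induction on the dimension. *)
Lemma rV_lebesgue0 (d : nat) : rV_lebesgue (set0 : set 'rV[R]_d) = 0%E.
Proof.
elim: d => [|d IH]; first by rewrite /= diracE in_set0.
rewrite /= /pushforward preimage_set0; apply: integral0_eq => t _ /=.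
by rewrite xsection0.
Qed.

(* By induction on d: unless the slices at height t are nondegenerate quadrics
   too, only the roots t of a t^2 + b_0 t = k have a nonempty slice. *)
Lemma rV_lebesgue_quadric (d : nat) (A : set 'rV[R]_d) (a k : R) (b : 'rV[R]_d) :
  (b != 0%R) || ((0 < d)%N && (a != 0%R)) ->
  (forall y, A y ->
    (a * (\sum_(i < d) y 0 i ^+ 2) + \sum_(i < d) b 0 i * y 0 i = k)%R) ->
  rV_lebesgue A = 0%E.
Proof.
elim: d A k b => [|d IH] A k b.
  by rewrite /= orbF => /negP[]; apply/eqP/rowP => -[].
move=> nz Aq /=; rewrite /pushforward.
pose b' : 'rV[R]_d := \row_j b 0 (lift ord0 j).
pose S t := xsection ((fun p : R * 'rV[R]_d =>
  row_mx p.1%:M p.2 : 'rV[R]_(1 + d)) @^-1` A) t.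
have SE t z : S t z ->
    (a * (t ^+ 2 + \sum_(i < d) z 0 i ^+ 2) +
      (b 0 ord0 * t + \sum_(i < d) b' 0 i * z 0 i) = k)%R.
  rewrite /S xsectionE/= => /Aq; rewrite !big_ord_recl.
  have e0 : (row_mx t%:M z : 'rV[R]_(1 + d)) 0 ord0 = t.
    transitivity ((row_mx t%:M z : 'rV[R]_(1 + d)) 0 (lshift d ord0)).
      by congr (row_mx _ _ _ _); exact/val_inj.
    by rewrite row_mxEl mxE.
  have eS j : (row_mx t%:M z : 'rV[R]_(1 + d)) 0 (lift ord0 j) = z 0 j.
    transitivity ((row_mx t%:M z : 'rV[R]_(1 + d)) 0 (rshift 1 j)).
      by congr (row_mx _ _ _ _); exact/val_inj.
    by rewrite row_mxEr.
  rewrite e0 (eq_bigr (fun j => z 0 j ^+ 2)) => [|j _]; last by rewrite eS.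
  rewrite [in X in _ + X](eq_bigr (fun j => b' 0 j * z 0 j)) => [//|j _].
  by rewrite eS mxE.
have [tz|] := boolP ((b' != 0%R) || ((0 < d)%N && (a != 0%R))).
  apply: integral0_eq => t _ /=.
  apply: (IH (S t) (k - a * t ^+ 2 - b 0 ord0 * t)%R b' tz) => z /SE; lra.
(* Degenerate slices: [b' = 0], and [d = 0] or [a = 0], so the sum of squares drops out and the
   equation involves [t] alone. *)
rewrite negb_or negbK => /andP[/eqP b'0 da].
have {SE} SE t : S t !=set0 -> (a * t ^+ 2 + b 0 ord0 * t = k)%R.
  move=> [z /SE]; rewrite b'0 [X in (_ + (_ + X))%R]big1 => [|i _]; last first.
    by rewrite mxE mul0r.
  have -> : (a * (t ^+ 2 + \sum_(i < d) z 0 i ^+ 2) = a * t ^+ 2)%R.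
    move: da; rewrite negb_and negbK -eqn0Ngt => /orP[/eqP d0|/eqP ->]; last first.
      by rewrite !mul0r.
    by rewrite big1 ?addr0// => -[i iltd]; exfalso; move: iltd; rewrite d0.
  by rewrite addr0.
have ab0 : (a != 0%R) || (b 0 ord0 != 0%R).
  case/orP: nz => [bn0|/andP[_ ->]//]; apply/orP; right.
  apply: contra bn0 => /eqP b0; apply/eqP/rowP => i; rewrite mxE.
  have [j ->|->//] := unliftP ord0 i.
  by have /rowP/(_ j) := b'0; rewrite !mxE.
have S0 t : ~ (S t !=set0) -> rV_lebesgue (S t) = 0%E.
  by move=> /set0P/negP/negPn/eqP ->; exact: rV_lebesgue0.
apply: (@integral_countable_support _ [set t | S t !=set0]); last exact: S0.
have [[t0 /SE St0]|none] := pselect (exists t, S t !=set0); last first.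
  by rewrite (_ : [set t | _] = set0)// -subset0 => t St; apply: none; exists t.
(* The roots of the quadratic add up to [- b 0 ord0 / a], so [t0] determines the other one. For
   [a = 0] the equation is linear and [t0] is its only root. *)
apply: (@sub_countable _ _ _ [set t0; - b 0 ord0 / a - t0]%R); last first.
  exact: finite_set_countable.
apply: subset_card_le => t /SE St /=.
have : ((t - t0) * (a * (t + t0) + b 0 ord0) = 0)%R.
  by transitivity (k - k)%R; [rewrite -{1}St -St0; ring|rewrite subrr].
move/eqP; rewrite mulf_eq0 subr_eq0 => /orP[/eqP ->|/eqP h]; first by left.
have [a0|a0] := eqVneq a 0%R.
  by move: ab0; rewrite a0 eqxx/=; move: h; rewrite a0 mul0r add0r => ->; rewrite eqxx.
right; apply: (mulfI a0).
have -> : (a * (- b 0 ord0 / a - t0) = - b 0 ord0 - a * t0)%R by field.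
by move: h; clear; lra.
Qed.

End lebesgue_quadrics.

Section euclidean_distance.
Variables (R : realType) (d : nat).
Implicit Types a b y : 'rV[R]_d.

Lemma edist_nneg y a : 0 <= edist y a.
Proof. exact: sqrtr_ge0. Qed.

Lemma edist_sqr y a : edist y a ^+ 2 = \sum_(i < d) (y 0 i - a 0 i) ^+ 2.
Proof. by rewrite sqr_sqrtr// sumr_ge0// => i _; rewrite sqr_ge0. Qed.

Lemma edist_refl0 y : edist y y = 0.
Proof.
by rewrite /edist big1 ?sqrtr0// => i _; rewrite subrr expr0n.
Qed.

Lemma open_measurable_rV (A : set 'rV[R]_d) : open A -> measurable A.
Proof. exact: (@sub_sigma_algebra _ setT (@open 'rV[R]_d) A). Qed.

Lemma closed_measurable_rV (A : set 'rV[R]_d) : closed A -> measurable A.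
Proof.
move=> cA; rewrite -(setCK A); apply: measurableC; apply: open_measurable_rV.
exact: closed_openC.
Qed.

Lemma continuous_measurable_rV (f : 'rV[R]_d -> R) :
  continuous f -> measurable_fun setT f.
Proof.
move=> /continuousP cf; apply: (measurability _ (RGenOInfty.measurableE R)).
move=> _ [_ [a ->] <-]; rewrite setTI; apply: open_measurable_rV; apply: cf.
exact: interval_open.
Qed.

Lemma measurable_coord_rV (i : 'I_d) :
  measurable_fun setT (fun y : 'rV[R]_d => y 0 i).
Proof. by apply: continuous_measurable_rV; exact: coord_continuous. Qed.

(** Argued through the coordinates, because the sigma-algebra on pairs is the product one. *)
Lemma measurable_edist :
  measurable_fun setT (fun p : 'rV[R]_d * 'rV[R]_d => edist p.1 p.2).
Proof.
have mcoord := measurable_coord_rV.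
apply: (measurable_comp measurableT (f := @Num.sqrt R)) => //.
  by apply: continuous_measurable_fun; exact: sqrt_continuous.
apply: measurable_sum => i; apply: measurable_funX.
by apply: measurable_funB; [apply: (measurableT_comp (mcoord i))|
  apply: (measurableT_comp (mcoord i))].
Qed.

Lemma measurable_edistl a : measurable_fun setT (fun y => edist y a).
Proof.
apply: (measurableT_comp (f := fun p => edist p.1 p.2)
  (g := fun y : 'rV[R]_d => (y, a))); first exact: measurable_edist.
exact: measurable_fun_pair.
Qed.

Lemma measurable_set1_rV a : measurable [set a].
Proof.
rewrite (_ : [set a] = setT `&` (fun y => edist y a) @^-1` [set 0]).
  exact: measurable_edistl.
rewrite setTI; apply/seteqP; split=> y /= => [->|ya]; first exact: edist_refl0.
have := edist_sqr y a; rewrite ya expr0n/= => /esym/eqP.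
rewrite psumr_eq0 => [/allP h|i _]; last exact: sqr_ge0.
apply/rowP => i; apply/eqP; rewrite -subr_eq0 -sqrf_eq0.
by apply: (h i); rewrite mem_index_enum.
Qed.

(** Brings spheres and bisectors into the form of [rV_lebesgue_quadric]. *)
Lemma edist_sqrE y a : edist y a ^+ 2 =
  \sum_(i < d) y 0 i ^+ 2 + \sum_(i < d) (- 2 *: a) 0 i * y 0 i
  + \sum_(i < d) a 0 i ^+ 2.
Proof.
rewrite edist_sqr -!big_split; apply: eq_bigr => i _ /=; rewrite mxE; ring.
Qed.

Variable mu : {finite_measure set 'rV[R]_d -> \bar R}.
Hypothesis mu_lebesgue : mu `<< @rV_lebesgue R d.

(** A quadric with leading coefficient 1, nondegenerate because [0 < d]. The radius 0 is included,
    so points are null as well. *)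
Lemma null_sphere a r : (0 < d)%N -> mu [set y | edist y a = r] = 0%E.
Proof.
move=> d0; set S := [set _ | _]; have /mu_lebesgue : (@rV_lebesgue R d).-null_set S.
  move=> A _ Ar.
  apply: (@rV_lebesgue_quadric _ _ _ 1 (r ^+ 2 - \sum_(i < d) a 0 i ^+ 2)
    (- 2 *: a)); first by rewrite d0 oner_neq0 orbT.
  by move=> y /Ar /= <-; rewrite edist_sqrE; ring.
apply => //; rewrite [X in measurable X](_ : _ =
    setT `&` (fun y => edist y a) @^-1` [set r]).
  exact: measurable_edistl.
by rewrite setTI.
Qed.

(** The squares cancel and leave a hyperplane with normal [-2 (a - b)]. *)
Lemma null_bisector a b : a != b -> mu [set y | edist y a = edist y b] = 0%E.
Proof.
move=> ab; set S := [set _ | _]; have /mu_lebesgue : (@rV_lebesgue R d).-null_set S.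
  move=> A _ Ar.
  apply: (@rV_lebesgue_quadric _ _ _ 0
    (\sum_(i < d) b 0 i ^+ 2 - \sum_(i < d) a 0 i ^+ 2) (- 2 *: a - (- 2 *: b))).
    by rewrite -scalerBr scaler_eq0 subr_eq0 (negPf ab) orbF oppr_eq0 pnatr_eq0.
  move=> y /Ar /= E; have : edist y a ^+ 2 = edist y b ^+ 2 by rewrite E.
  rewrite !edist_sqrE mul0r add0r.
  have -> : \sum_(i < d) (- 2 *: a - - 2 *: b) 0 i * y 0 i =
      \sum_(i < d) (- 2 *: a) 0 i * y 0 i - \sum_(i < d) (- 2 *: b) 0 i * y 0 i.
    by rewrite -sumrB; apply: eq_bigr => i _; rewrite !mxE; ring.
  by move=> h; lra.
apply => //; rewrite [X in measurable X](_ : _ =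
    setT `&` (fun y => edist y a - edist y b) @^-1` [set 0]).
  by apply: measurable_funB => //; exact: measurable_edistl.
rewrite setTI; apply/seteqP; split=> y /= => [->|/eqP]; first by rewrite subrr.
by rewrite subr_eq0 => /eqP.
Qed.

End euclidean_distance.

(** * Nearest sites and Voronoi cells *)

Section nearest_site.
Variables (R : realType) (d M : nat) (x : 'I_M -> 'rV[R]_d) (i0 : 'I_M).
Implicit Type y : 'rV[R]_d.

Definition is_nearest y (k : 'I_M) : bool :=
  [forall j, edist y (x k) <= edist y (x j)].

(* Ties are broken by the least index, which makes the cells measurable. *)
Definition nearest y : 'I_M :=
  [arg min_(k < [arg min_(j < i0) edist y (x j)]%O | is_nearest y k) (k : nat)]%N.

Definition nearest_dist y : R := edist y (x (nearest y)).

Lemma nearestP y : is_nearest y (nearest y) /\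
  forall k, is_nearest y k -> (nearest y <= k)%N.
Proof.
rewrite /nearest; case: arg_minnP; last by move=> k.
(* The inner minimizer in [nearest] only witnesses that some index is nearest, as the outer one
   requires. *)
by case: Order.TotalTheory.arg_minP => // j _ jmin; apply/forallP => k; exact: jmin.
Qed.

Lemma nearest_dist_le y j : nearest_dist y <= edist y (x j).
Proof. by have [/forallP/(_ j)] := nearestP y. Qed.

Lemma nearest_dist_ge0 y : 0 <= nearest_dist y.
Proof. exact: edist_nneg. Qed.

Lemma nearest_voronoi (Omega : set 'rV[R]_d) k y : voronoi Omega x k y ->
  edist y (x k) = nearest_dist y.
Proof.
by move=> [_ h]; apply/eqP; rewrite eq_le nearest_dist_le andbT h.
Qed.

Lemma voronoi_nearest (Omega : set 'rV[R]_d) y : Omega y ->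
  voronoi Omega x (nearest y) y.
Proof. by move=> Oy; split=> // j; exact: nearest_dist_le. Qed.

Lemma measurable_edist_le (j k : 'I_M) :
  measurable [set y | edist y (x k) <= edist y (x j)].
Proof.
rewrite [X in measurable X](_ : _ =
  setT `&` (fun y => edist y (x k) - edist y (x j)) @^-1` `]-oo, 0]%classic).
  by apply: measurable_funB => //; exact: measurable_edistl.
by rewrite setTI; apply/seteqP; split=> y /=; rewrite in_itv/= subr_le0.
Qed.

Lemma measurable_voronoi (Omega : set 'rV[R]_d) k : measurable Omega ->
  measurable (voronoi Omega x k).
Proof.
move=> mO; rewrite [X in measurable X](_ : _ = Omega `&`
    \bigcap_(j in [set: 'I_M]) [set y | edist y (x k) <= edist y (x j)]).
  apply: measurableI => //; apply: fin_bigcap_measurable => // j _.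
  exact: measurable_edist_le.
by apply/seteqP; split=> y /= [Oy h]; split=> // j; [move=> _; exact: h|exact: h].
Qed.

(** By the rule for ties, this is the Voronoi cell of [k] in the whole space minus those of smaller
    index. *)
Lemma measurable_nearest k : measurable [set y | nearest y = k].
Proof.
pose N j := [set y | is_nearest y j].
have mN j : measurable (N j).
  rewrite (_ : N j = voronoi setT x j); first exact: measurable_voronoi.
  by apply/seteqP; split=> y /=; [move/forallP|move=> [_ /forallP]].
rewrite [X in measurable X](_ : _ =
    N k `\` \bigcup_(j in [set j : 'I_M | (j < k)%N]) N j).
  by apply: measurableD => //; apply: fin_bigcup_measurable.
apply/seteqP; split=> y /=.
  move=> <-; have [h1 h2] := nearestP y; split=> // -[j /= jk /h2].
  by rewrite leqNgt jk.
move=> [Nk nN]; apply/val_inj/eqP; rewrite eqn_leq /=.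
have [h1 h2] := nearestP y; rewrite h2//= leqNgt; apply/negP => h.
by apply: nN; exists (nearest y).
Qed.

Lemma measurable_nearest_preimage (B : set 'I_M) :
  measurable [set y | B (nearest y)].
Proof.
rewrite [X in measurable X](_ : _ = \bigcup_(k in B) [set y | nearest y = k]).
  by apply: fin_bigcup_measurable => // k _; exact: measurable_nearest.
by apply/seteqP; split=> y /=; [exists (nearest y)|move=> [k Bk /= ->]].
Qed.

Lemma measurable_nearest_site : measurable_fun setT (fun y => x (nearest y)).
Proof.
by move=> _ B _; rewrite setTI; exact: (measurable_nearest_preimage (x @^-1` B)).
Qed.

Lemma measurable_nearest_dist : measurable_fun setT nearest_dist.
Proof.
apply: (measurableT_comp (f := fun p => edist p.1 p.2)
  (g := fun y => (y, x (nearest y)))); first exact: measurable_edist.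
by apply: measurable_fun_pair => //; exact: measurable_nearest_site.
Qed.

End nearest_site.

(** * Densities and discrepancies *)

Section densities.
Context d (T : measurableType d) (R : realType).
Variable mu : {finite_measure set T -> \bar R}.
Local Open Scope ereal_scope.

Lemma exists_density (s : T -> R) (C : R) : measurable_fun setT s ->
  (forall y, 0 <= s y <= C)%R ->
  exists nu : {finite_measure set T -> \bar R},
    forall A, nu A = \int[mu]_(y in A) (s y)%:E.
Proof.
move=> ms sC; pose nu A := \int[mu]_(y in A) (s y)%:E.
have s0 y : 0 <= (s y)%:E by rewrite lee_fin; have /andP[] := sC y.
have mse : measurable_fun setT (fun y => (s y)%:E) by exact/measurable_EFinP.
have nu0 : nu set0 = 0 by exact: integral_set0.
have nu_ge0 A : 0 <= nu A by exact: integral_ge0.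
have nu_sigma : semi_sigma_additive nu.
  exact: semi_sigma_additive_nng_induced.
have nu_fin : fin_num_fun nu.
  move=> A mA; rewrite ge0_fin_numE//.
  apply: (@le_lt_trans _ _ (\int[mu]_(y in A) C%:E)).
    apply: ge0_le_integral => //.
    - exact: measurable_funTS.
    - by move=> y _; rewrite lee_fin; have /andP[] := sC y.
  by rewrite integral_cst// ltey_eq fin_numM// fin_num_measure.
pose nu_measure := isMeasure.Build _ _ _ nu nu0 nu_ge0 nu_sigma.
pose nu_m : {measure set T -> \bar R} := HB.pack nu nu_measure.
pose nu_finite := Measure_isFinite.Build _ _ _ nu_m nu_fin.
pose nu_f : {finite_measure set T -> \bar R} := HB.pack nu nu_measure nu_finite.
by exists nu_f.
Qed.

Variables (nu : {finite_measure set T -> \bar R}) (s : T -> R).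
Hypothesis ms : measurable_fun setT s.
Hypothesis s0 : forall y, (0 <= s y)%R.
Hypothesis nuE : forall A, measurable A -> nu A = \int[mu]_(y in A) (s y)%:E.

Let mse : measurable_fun setT (fun y => (s y)%:E).
Proof. exact/measurable_EFinP. Qed.

Lemma density_dominates : nu `<< mu.
Proof.
apply/null_content_dominatesP => A mA muA0.
by rewrite nuE//; apply: null_set_integral => //; exact: measurable_funTS.
Qed.

Lemma Radon_Nikodym_density : ae_eq mu setT
  (Radon_Nikodym (charge_of_finite_measure nu) mu) (fun y => (s y)%:E).
Proof.
apply: integral_ae_eq => //.
  by apply: Radon_Nikodym_integrable; exact: density_dominates.
move=> A _ mA; rewrite -nuE//.
by rewrite -Radon_Nikodym_integral//; exact: density_dominates.
Qed.

(** The change of variables is available for the density [Radon_Nikodym_SigmaFinite.f], which agrees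
    with [s] almost everywhere because both have the same integrals. *)
Lemma ge0_integral_density (h : T -> \bar R) (E : set T) : measurable E ->
  measurable_fun E h -> (forall y, 0 <= h y) ->
  \int[nu]_(y in E) h y = \int[mu]_(y in E) (h y * (s y)%:E).
Proof.
move=> mE mh h0; have dom := density_dominates.
rewrite -(Radon_Nikodym_SigmaFinite.change_of_variables dom)//.
set f := Radon_Nikodym_SigmaFinite.f nu mu.
have mf : measurable_fun setT f.
  exact: measurable_int (Radon_Nikodym_SigmaFinite.f_integrable dom).
have ff : ae_eq mu E f (fun y => (s y)%:E).
  apply: integral_ae_eq => //.
  - exact: (integrableS measurableT) (Radon_Nikodym_SigmaFinite.f_integrable dom).
  - exact: measurable_funTS.
  - by move=> A _ mA; rewrite -nuE// -Radon_Nikodym_SigmaFinite.f_integral.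
apply: ge0_ae_eq_integral => //.
- by apply: emeasurable_funM => //; exact: measurable_funTS.
- by apply: emeasurable_funM => //; exact: measurable_funTS.
- by move=> y _; rewrite mule_ge0// Radon_Nikodym_SigmaFinite.f_ge0.
- by move=> y _; rewrite mule_ge0// lee_fin.
- exact: ae_eqe_mul2l.
Qed.

End densities.

Lemma exists_pushforward d1 d2 (T1 : measurableType d1) (T2 : measurableType d2)
    (R : realType) (nu : {finite_measure set T1 -> \bar R}) (g : T1 -> T2) :
  measurable_fun setT g -> exists nu' : {finite_measure set T2 -> \bar R},
    nu' = pushforward nu g :> (set T2 -> \bar R).
Proof.
move=> mg; pose p : set T2 -> \bar R := pushforward nu g.
have [p0 p_ge0 p_sigma] : [/\ p set0 = 0%E, forall A, (0 <= p A)%E &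
    semi_sigma_additive p].
  pose gnu : {measure set T2 -> \bar R} :=
    measure_function_pushforward__canonical__measure_function_Measure nu mg.
  split; [exact: (measure0 gnu)|exact: (measure_ge0 gnu)|].
  exact: (@measure_semi_sigma_additive _ _ _ gnu).
have p_fin : fin_num_fun p.
  move=> A mA; apply: fin_num_measure.
  by rewrite -[X in measurable X]setTI; exact: mg.
pose p_measure := isMeasure.Build _ _ _ p p0 p_ge0 p_sigma.
pose p_m : {measure set T2 -> \bar R} := HB.pack p p_measure.
pose p_finite := Measure_isFinite.Build _ _ _ p_m p_fin.
pose p_f : {finite_measure set T2 -> \bar R} := HB.pack p p_measure p_finite.
by exists p_f.
Qed.

(** Truncating the argument at 0 makes [f] monotone on the whole line, so that preimages of rays are
    intervals. *)
Lemma measurable_nondecreasing_comp d (T : measurableType d) (R : realType)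
    (f : R -> \bar R) (r : T -> R) :
  (forall u v, 0 <= u <= v -> (f u <= f v)%E) ->
  measurable_fun setT r -> (forall y, 0 <= r y) ->
  measurable_fun setT (fun y => f (r y)).
Proof.
move=> fnd mr r0; pose g u := f (Num.max u 0).
have mg : measurable_fun setT g.
  apply: (measurability _ (ErealGenCInfty.measurableE R)) => /= _ [_ [a ->] <-].
  rewrite setTI; apply: is_interval_measurable => u v /=.
  rewrite !in_itv/= !andbT => au _ w /andP[uw _]; rewrite in_itv/= andbT.
  apply: (le_trans au); apply: fnd; rewrite le_max lexx orbT/=.
  by rewrite ge_max !le_max uw lexx/= orbT.
rewrite (_ : (fun y => _) = g \o r); first exact: measurableT_comp.
by apply/funext => y; rewrite /g/= max_l.
Qed.

Section null_complement.
Context d (T : measurableType d) (R : realType) (mu : {measure set T -> \bar R}).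
Variable D : set T.
Hypotheses (mD : measurable D) (muD : mu (~` D) = 0%E).

Lemma ge0_integral_conull (h : T -> \bar R) : measurable_fun setT h ->
  (forall y, (0 <= h y)%E) -> (\int[mu]_(y in D) h y = \int[mu]_y h y)%E.
Proof.
move=> mh h0; rewrite [RHS](ge0_negligible_integral (measurableC mD))//.
by rewrite setTD setCK.
Qed.

Lemma ae_conull : {ae mu, forall y, D y}.
Proof. by exists (~` D); split => //; exact: measurableC. Qed.

End null_complement.

Section discrepancy_theory.
Variables (R : realType) (d : nat) (F : R -> \bar R) (Omega : set 'rV[R]_d).
Hypotheses (hF : is_entropy F) (mOmega : measurable Omega).
Variables mu rho : {finite_measure set 'rV[R]_d -> \bar R}.
Local Open Scope ereal_scope.

Lemma measurable_entropy : measurable_fun setT F.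
Proof. by apply: lower_semicontinuous_measurable; exact: entropy_lsc. Qed.

Lemma discrepancy_ge0 : 0 <= discrepancy F Omega rho mu.
Proof.
rewrite /discrepancy; case: ifPn => // _.
by apply: integral_ge0 => y _; exact: entropy_ge0.
Qed.

Lemma discrepancy_lty_dominates : discrepancy F Omega rho mu < +oo -> rho `<< mu.
Proof. by rewrite /discrepancy; case: ifPn => [/asboolP//|_]; rewrite ltxx. Qed.

(** Frees the discrepancy from the particular derivative in its definition, so that more convenient
    versions can be used. *)
Lemma discrepancyE (s : 'rV[R]_d -> \bar R) : rho `<< mu ->
  measurable_fun setT s ->
  ae_eq mu setT s (Radon_Nikodym (charge_of_finite_measure rho) mu) ->
  discrepancy F Omega rho mu = \int[mu]_(y in Omega) F (fine (s y)).
Proof.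
move=> dom ms sE; rewrite /discrepancy asboolT//.
have mF (f : 'rV[R]_d -> \bar R) :
    measurable_fun setT f -> measurable_fun Omega (fun y => F (fine (f y))).
  move=> mf; apply: measurable_funTS; apply: (measurableT_comp measurable_entropy).
  exact: measurableT_comp mf.
apply: ge0_ae_eq_integral => //.
- by apply: mF; apply: (measurable_int mu); exact: Radon_Nikodym_integrable.
- exact: mF.
- by move=> y _; exact: entropy_ge0.
- by move=> y _; exact: entropy_ge0.
- by apply: filterS sE => y /(_ Logic.I) -> _.
Qed.

Lemma discrepancy_density (s : 'rV[R]_d -> R) : measurable_fun setT s ->
  (forall A, measurable A -> rho A = \int[mu]_(y in A) (s y)%:E) ->
  discrepancy F Omega rho mu = \int[mu]_(y in Omega) F (s y).
Proof.
move=> ms rhoE; rewrite (@discrepancyE (fun y => (s y)%:E))//.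
- exact: density_dominates ms rhoE.
- exact/measurable_EFinP.
- exact/ae_eq_sym/(Radon_Nikodym_density ms rhoE).
Qed.

End discrepancy_theory.

(** * Optimal plans for given sites *)

Section tessellation.
Variables (R : realType) (d M : nat) (Omega : set 'rV[R]_d).
Variables (c : 'rV[R]_d -> 'rV[R]_d -> \bar R) (l F : R -> \bar R).
Variable mu : {finite_measure set 'rV[R]_d -> \bar R}.
Hypotheses (d_gt0 : (0 < d)%N) (mOmega : measurable Omega).
Hypotheses (hl : is_radial_profile l) (hF : is_entropy F) (hF1 : F 1 = 0%E).
Hypothesis cE : forall y z, Omega y -> Omega z -> c y z = l (edist y z).
Hypotheses (muOmega : mu (~` Omega) = 0%E) (muL : mu `<< @rV_lebesgue R d).
Variables (x : 'I_M -> 'rV[R]_d) (i0 : 'I_M).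
Hypothesis xOmega : in_domain Omega x.
Local Open Scope ereal_scope.

Let r := nearest_dist x i0.
Let r0 y : (0 <= r y)%R. Proof. exact: nearest_dist_ge0. Qed.
Let mr : measurable_fun setT r. Proof. exact: measurable_nearest_dist. Qed.

Definition optimal_value : \bar R := \int[mu]_(y in Omega) cost_density F l (r y).

Lemma measurable_nearest_cost :
  measurable_fun setT (fun y => cost_density F l (nearest_dist x i0 y)).
Proof.
apply: (@measurable_nondecreasing_comp _ _ _ (cost_density F l)) => // u v.
exact: cost_density_nondecreasing.
Qed.

Let m_cost : measurable_fun setT (fun y => cost_density F l (r y)).
Proof. exact: measurable_nearest_cost. Qed.

Let cost_ge0 y : 0 <= cost_density F l (r y).
Proof. exact: cost_density_ge0. Qed.

Let m_profile : measurable_fun setT (fun y => l (r y)).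
Proof.
by apply: (@measurable_nondecreasing_comp _ _ _ l) => // u v; exact: radial_nondecreasing.
Qed.

Let profile_ge0 y : 0 <= l (r y).
Proof. exact: radial_ge0. Qed.

Let m_mass : measurable_fun setT (fun y => mass_density F l (r y)).
Proof.
have mg : measurable_fun setT (fun u : R => mass_density F l (Num.max u 0%R)).
  apply: nonincreasing_measurable => // u v uv.
  apply: (mass_density_nonincreasing hF hl); rewrite le_max lexx orbT/=.
  by rewrite ge_max !le_max uv lexx/= orbT.
apply: (eq_measurable_fun _ _ (measurableT_comp mg mr)) => y _ /=.
by rewrite max_l.
Qed.

Lemma mass_density_bound y :
  (0 <= mass_density F l (r y) <= mass_density F l 0%R)%R.
Proof.
rewrite (mass_density_ge0 hF hl)//=; apply: (mass_density_nonincreasing hF hl).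
by rewrite lexx r0.
Qed.

Lemma ae_single_valued a :
  {ae mu, forall y, exists! s, subdiff_conjugateE F (- l (edist y a)) s}.
Proof.
have /countable_injP[f finj] := multivalued_countable hF hl.
set B := [set u | _] in finj.
(* Since [f] is injective on the multivalued distances, each [N n] lies in a single sphere around
   [a]. *)
pose N n := [set y | B (edist y a) /\ f (edist y a) = n].
apply: (@negligibleS _ _ _ _ (\bigcup_n N n)).
  move=> y /= ny; exists (f (edist y a)) => //; split=> //; split=> //.
  exact: edist_nneg.
apply: negligible_bigcup => n.
have [[y0 [By0 fy0]]|Nn0] := pselect (N n !=set0); last first.
  rewrite (_ : N n = set0); first exact: negligible_set0.
  by rewrite -subset0 => y Ny; apply: Nn0; exists y.
exists [set y | edist y a = edist y0 a]; split.
- rewrite [X in measurable X](_ : _ =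
    setT `&` (fun y => edist y a) @^-1` [set edist y0 a]).
    exact: measurable_edistl.
  by rewrite setTI.
- exact: null_sphere.
- by move=> y [By fy]; apply: finj; rewrite ?inE// fy.
Qed.

Lemma ae_single_valued_nearest :
  {ae mu, forall y, exists! s, subdiff_conjugateE F (- l (r y)) s}.
Proof.
have : {ae mu, forall y, forall i : 'I_M,
    exists! s, subdiff_conjugateE F (- l (edist y (x i))) s}.
  apply: filter_forall => i; exact: ae_single_valued.
by apply: filterS => y h; exact: h.
Qed.

(** Sites are spheres of radius 0. The positivity is what [mass_density_eq0] asks for. *)
Lemma ae_nearest_dist_gt0 : {ae mu, forall y, (0 < r y)%R}.
Proof.
have : {ae mu, forall y, forall i : 'I_M, edist y (x i) <> 0%R}.
  apply: filter_forall => i; exists [set y | edist y (x i) = 0%R]; split.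
  - rewrite [X in measurable X](_ : _ =
      setT `&` (fun y => edist y (x i)) @^-1` [set 0%R]).
      exact: measurable_edistl.
    by rewrite setTI.
  - exact: null_sphere.
  - by move=> y /= /contrapT.
by apply: filterS => y h; rewrite lt_neqAle r0 andbT eq_sym; apply/eqP; exact: h.
Qed.

(** * Lower bound for the energy and its equality case *)

Section lower_bound.
Variables (m : 'I_M -> {nonneg R}).
Variable g : {finite_measure set ('rV[R]_d * 'rV[R]_d)%type -> \bar R}.
Hypothesis gplan : transport_plan Omega g.

Let OO := Omega `*` Omega.
Let nu := discrete_measure x m.

Let mOO : measurable OO. Proof. exact: measurableX. Qed.

Let m_profile1 :
  measurable_fun setT (fun p : 'rV[R]_d * 'rV[R]_d => l (r p.1)).
Proof. exact: (measurableT_comp m_profile measurable_fst). Qed.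

Let m_c : measurable_fun OO (fun p => c p.1 p.2).
Proof.
have : measurable_fun setT (fun p : 'rV[R]_d * 'rV[R]_d => l (edist p.1 p.2)).
  apply: (@measurable_nondecreasing_comp _ _ _ l).
  - by move=> u v; exact: radial_nondecreasing.
  - exact: measurable_edist.
  - by move=> p; exact: edist_nneg.
move=> /(measurable_funS measurableT (@subsetT _ OO)).
apply: eq_measurable_fun => p; rewrite inE => -[yO1 yO2].
by rewrite -cE.
Qed.

Let c_ge0 p : OO p -> 0 <= c p.1 p.2.
Proof. by move=> [yO1 yO2]; rewrite cE//; apply: radial_ge0 => //; exact: edist_nneg. Qed.

(** A finite discrepancy makes the second marginal absolutely continuous with respect to [nu], which
    does not charge the complement of the sites. *)
Lemma ae_second_site : discrepancy F Omega (marginal2 g) nu < +oo ->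
  {ae g, forall p, exists i, p.2 = x i}.
Proof.
move=> /discrepancy_lty_dominates/null_content_dominatesP dom.
pose B := ~` \bigcup_(i in [set: 'I_M]) [set x i].
have mB : measurable B.
  apply: measurableC; apply: fin_bigcup_measurable => // i _.
  exact: measurable_set1_rV.
exists (snd @^-1` B); split.
- by rewrite -[X in measurable X]setTI; exact: measurable_snd.
- apply: (dom B mB); rewrite /nu /= /discrete_measure big1// => i _.
  by rewrite diracE memNset ?mule0// ; apply; exists i.
- by move=> p /= np [i _ /= pi]; apply: np; exists i.
Qed.

Lemma nearest_profile_le y i : Omega y -> l (r y) <= c y (x i).
Proof.
move=> Oy; rewrite cE//; apply: (radial_nondecreasing hl).
by rewrite r0 nearest_dist_le.
Qed.

Lemma nearest_transport_le : discrepancy F Omega (marginal2 g) nu < +oo ->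
  \int[g]_(p in OO) l (r p.1) <= \int[g]_(p in OO) c p.1 p.2.
Proof.
move=> /ae_second_site ae2; apply: ae_ge0_le_integral => //.
  exact: measurable_funTS.
by apply: filterS ae2 => p [i pi] [yO1 _]; rewrite pi; exact: nearest_profile_le.
Qed.

(** The cost to the nearest site depends on the first point only, so both terms become integrals
    against [mu], and [cost_density_le] compares the integrands pointwise. *)
Lemma optimal_value_le_nearest : optimal_value <=
  \int[g]_(p in OO) l (r p.1) + discrepancy F Omega (marginal1 g) mu.
Proof.
have [dom|ndom] := pselect (marginal1 g `<< mu); last first.
  rewrite /discrepancy asboolF// addey ?leey// gt_eqF//.
  by rewrite (lt_le_trans ltNy0)//; apply: integral_ge0.
(* This version of the density is finite and nonnegative everywhere, so [fine] loses nothing. *)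
pose f := Radon_Nikodym_SigmaFinite.f (marginal1 g) mu.
have f0 y : 0 <= f y by exact: Radon_Nikodym_SigmaFinite.f_ge0.
have ff y : f y \is a fin_num by exact: Radon_Nikodym_SigmaFinite.f_fin_num.
have mf : measurable_fun setT f.
  exact: measurable_int (Radon_Nikodym_SigmaFinite.f_integrable dom).
have mFf : measurable_fun setT (fun y => F (fine (f y))).
  apply: (measurableT_comp (measurable_entropy hF)).
  exact: measurableT_comp mf.
rewrite (@discrepancyE _ _ _ _ hF mOmega _ _ f dom mf); last first.
  exact: ae_eq_Radon_Nikodym_SigmaFinite.
rewrite (ge0_integral_conull mOO gplan)//.
have -> : \int[g]_p l (r p.1) = \int[marginal1 g]_y l (r y).
  by rewrite /marginal1 /= (ge0_integral_pushforward measurable_fst).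
rewrite -(Radon_Nikodym_SigmaFinite.change_of_variables dom)//.
rewrite /optimal_value !(ge0_integral_conull mOmega muOmega)//; last first.
  by move=> y; exact: entropy_ge0.
rewrite -ge0_integralD//; last 3 first.
- by move=> y _; rewrite mule_ge0.
- by apply: emeasurable_funM.
- by move=> y _; exact: entropy_ge0.
apply: ge0_le_integral => //.
- by apply: emeasurable_funD => //; exact: emeasurable_funM.
- move=> y _; rewrite -[X in _ * X]fineK//.
  by apply: cost_density_le => //; exact: fine_ge0.
Qed.

Lemma optimal_value_le_energy :
  optimal_value <= transport_energy F c Omega mu nu g.
Proof.
rewrite /transport_energy -/OO.
have [C|C] := ltP (discrepancy F Omega (marginal2 g) nu) (+oo).
  apply: (le_trans optimal_value_le_nearest).
  rewrite -[leLHS]adde0; apply: leeD; last exact: discrepancy_ge0.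
  by apply: leeD => //; exact: nearest_transport_le.
move: C; rewrite leye_eq => /eqP ->; rewrite addey ?leey// gt_eqF//.
rewrite (lt_le_trans ltNy0)// adde_ge0// ?discrepancy_ge0//.
exact: integral_ge0.
Qed.

(* In the equality case the cost of g-almost every pair (y, x_i) is the cost of
   the nearest site, and l is strictly increasing where it is finite. *)
Lemma optimal_plan_voronoi :
  transport_energy F c Omega mu nu g <= optimal_value -> optimal_value < +oo ->
  g (~` \bigcup_(i in [set: 'I_M]) (voronoi Omega x i `*` [set x i])) = 0.
Proof.
move=> Eopt opty; have E_lty := le_lt_trans Eopt opty.
move: Eopt E_lty; rewrite /transport_energy -/OO.
set A := \int[g]_(p in OO) _; set B := discrepancy _ _ _ mu.
set C := discrepancy _ _ _ nu => Eopt.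
have A0 : 0 <= A by exact: integral_ge0.
have B0 : 0 <= B by exact: discrepancy_ge0.
have C0 : 0 <= C by exact: discrepancy_ge0.
move=> E_lty.
have A_lty : A < +oo.
  by apply: le_lt_trans E_lty; rewrite -addeA leeDl// adde_ge0.
have B_lty : B < +oo.
  by apply: le_lt_trans E_lty; rewrite addeAC leeDr// adde_ge0.
have C_lty : C < +oo by apply: le_lt_trans E_lty; rewrite leeDr// adde_ge0.
have B_fin : B \is a fin_num by rewrite ge0_fin_numE.
have A_fin : A \is a fin_num by rewrite ge0_fin_numE.
(* With [I] the left integral, [A + B <= A + B + C <= optimal_value <= I + B]; cancelling the finite
   [B] gives [A <= I]. *)
have A_eq : \int[g]_(p in OO) l (r p.1) = A.
  apply/eqP; rewrite eq_le nearest_transport_le//=.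
  rewrite -(leeD2rE _ _ B_fin); apply: le_trans optimal_value_le_nearest.
  by apply: le_trans Eopt; rewrite leeDl.
have int_c : g.-integrable OO (fun p => c p.1 p.2).
  apply/integrableP; split=> //.
  by under eq_integral => p /[!inE] pO do rewrite gee0_abs ?c_ge0//.
have int_l : g.-integrable OO (fun p => l (r p.1)).
  apply/integrableP; split; first exact: measurable_funTS.
  by under eq_integral => p _ do rewrite gee0_abs//; rewrite A_eq.
have ae_le : {ae g, forall p, OO p -> l (r p.1) <= c p.1 p.2 /\
    c p.1 p.2 \is a fin_num /\ exists i, p.2 = x i}.
  have := integrable_ae mOO int_c; have := ae_second_site C_lty.
  apply: filterS2 => p [i pi] cfin pO; split; last by split; [exact: cfin|exists i].
  by rewrite pi; apply: nearest_profile_le; case: pO.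
(* The difference is nonnegative almost everywhere and has integral [A - A = 0]. *)
have ae_eq_cost : ae_eq g OO (fun p => c p.1 p.2 - l (r p.1)) (cst 0).
  have m_diff : measurable_fun OO (fun p => c p.1 p.2 - l (r p.1)).
    by apply: emeasurable_funB => //; exact: measurable_funTS.
  apply/(ae_eq_integral_abs g mOO m_diff).
  rewrite (ae_eq_integral (fun p => c p.1 p.2 - l (r p.1)))//.
  - by rewrite integralB// A_eq subee.
  - exact: measurableT_comp.
  - apply: filterS ae_le => p h /h[le_c [c_fin _]].
    by rewrite gee0_abs// sube_ge0// c_fin orbT.
apply: measure_negligible.
  apply: measurableC; apply: fin_bigcup_measurable => // i _.
  apply: measurableX; first exact: measurable_voronoi.
  exact: measurable_set1_rV.
suff : {ae g, forall p,
    (\bigcup_(i in [set: 'I_M]) (voronoi Omega x i `*` [set x i])) p} by [].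
have ae_OO := ae_conull mOO gplan.
apply: filterS3 ae_le ae_eq_cost ae_OO.
move=> [y z] /= le_c eq_c yzO; have [yO _] := yzO.
have {le_c} [_ [c_fin [i zi]]] := le_c yzO; have {eq_c} := eq_c yzO.
rewrite zi in c_fin * => /= /eqP; rewrite sube_eq ?c_fin ?fin_num_adde_defr//.
rewrite add0e cE// => /eqP cl; exists i => //; split=> //=; split=> // j.
apply: le_trans (nearest_dist_le x i0 y j); rewrite leNgt; apply/negP => lt_r.
have := radial_increasing hl (_ : (0 <= r y < edist y (x i))%R).
rewrite r0 lt_r -cl ltxx => /(_ isT) h; suff : false by [].
by apply: h; rewrite ltey_eq -cE// c_fin.
Qed.

End lower_bound.

(** Unlike the Voronoi cells, these are disjoint and cover the whole space, so integrals split over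
    them exactly. *)
Definition cell (k : 'I_M) : set 'rV[R]_d := [set y | nearest x i0 y = k].

Let mcell k : measurable (cell k). Proof. exact: measurable_nearest. Qed.

Lemma ge0_integral_cells (h : 'rV[R]_d -> \bar R) (A : set 'rV[R]_d) :
  measurable A -> measurable_fun setT h -> (forall y, 0 <= h y) ->
  \int[mu]_(y in A) h y = \sum_(k < M) \int[mu]_(y in A `&` cell k) h y.
Proof.
move=> mA mh h0.
have {1}-> : A = \big[setU/set0]_(k <- index_enum 'I_M) (A `&` cell k).
  rewrite -bigcup_seq; apply/seteqP; split=> y; last by move=> [k _ []].
  by move=> Ay; exists (nearest x i0 y) => //=; rewrite mem_index_enum.
apply: (@ge0_integral_bigsetU _ _ _ _ _ (fun k => A `&` cell k)) => //.
- by move=> k; apply: measurableI.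
- exact: index_enum_uniq.
- apply/trivIsetP => i j _ _ /eqP ij; rewrite -subset0 => y [[_ yi] [_ yj]].
  by apply: ij; transitivity (nearest x i0 y).
- exact: measurable_funTS.
Qed.

(** * The plan to the nearest site *)

Section transport_to_nearest.
Variable rho : {finite_measure set 'rV[R]_d -> \bar R}.
Hypothesis rhoE : forall A,
  rho A = \int[mu]_(y in A) (mass_density F l (r y))%:E.
Variable g : {finite_measure set ('rV[R]_d * 'rV[R]_d)%type -> \bar R}.
Hypothesis gE : g = pushforward rho (fun y => (y, x (nearest x i0 y)))
  :> (set _ -> \bar R).
Variable m : 'I_M -> {nonneg R}.
Hypothesis mE : forall k,
  (m k)%:num%:E = \int[mu]_(y in cell k) (mass_density F l (r y))%:E.

Let nu := discrete_measure x m.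

Let mass_ge0 y : 0 <= (mass_density F l (r y))%:E.
Proof. by rewrite lee_fin; have /andP[] := mass_density_bound y. Qed.

Let m_mass_e : measurable_fun setT (fun y => (mass_density F l (r y))%:E).
Proof. exact/measurable_EFinP. Qed.

Let m_graph : measurable_fun setT (fun y => (y, x (nearest x i0 y))).
Proof. by apply: measurable_fun_pair => //; exact: measurable_nearest_site. Qed.

Let rho_Omega : rho (~` Omega) = 0.
Proof.
rewrite rhoE; apply: null_set_integral => //; first exact: measurableC.
exact: measurable_funTS.
Qed.

Lemma nearest_transport_plan : transport_plan Omega g.
Proof.
rewrite /transport_plan/= gE /pushforward; apply: subset_measure0 rho_Omega.
- rewrite -[X in measurable X]setTI; apply: m_graph => //.
  by apply: measurableC; exact: measurableX.
- exact: measurableC.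
- by move=> y /= h yO; apply: h.
Qed.

(** The plan sends to the site of index [k] exactly the mass of [cell k], which is [m k]. *)
Lemma nearest_plan_marginal2 A : measurable A -> marginal2 g A = nu A.
Proof.
move=> mA; rewrite /marginal2 /pushforward gE /pushforward rhoE.
rewrite ge0_integral_cells//; last first.
  by rewrite -[X in measurable X]setTI; apply: (measurable_nearest_site x i0).
rewrite /nu /= /discrete_measure; apply: eq_bigr => k _; rewrite mE diracE.
have [xA|xA] := boolP (x k \in A).
  rewrite mule1; congr (integral mu _ _); apply/seteqP; split=> y; first by case.
  by move=> yk; split=> //=; move: xA; rewrite inE -yk.
rewrite mule0 [X in integral mu X](_ : _ = set0) ?integral_set0//.
by rewrite -subset0 => y [/= Ax yk]; move: xA; rewrite notin_setE -yk.
Qed.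

Lemma nearest_plan_energy :
  transport_energy F c Omega mu nu g = optimal_value.
Proof.
have dom : rho `<< mu by apply: density_dominates m_mass _ => A _; exact: rhoE.
rewrite /transport_energy.
(* The second marginal is [nu] itself, so its density is 1 and [F 1 = 0] applies. *)
have -> : discrepancy F Omega (marginal2 g) nu = 0.
  rewrite (@discrepancy_density _ _ _ _ hF mOmega _ _ (cst 1%R))//.
    by rewrite integral0_eq.
  move=> A mA; rewrite (eq_integral (cst 1))// integral_cst// mul1e.
  exact: nearest_plan_marginal2.
rewrite (@discrepancy_density _ _ _ _ hF mOmega _ _
  (fun y => mass_density F l (r y)))//; last first.
  move=> A _; rewrite -rhoE; exact: (congr1 (fun f => f (fst @^-1` A)) gE).
rewrite adde0.
have -> : \int[g]_(p in Omega `*` Omega) c p.1 p.2 =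
    \int[mu]_(y in Omega) (l (r y) * (mass_density F l (r y))%:E).
  have m_profile2 : measurable_fun setT (fun p : 'rV[R]_d * 'rV[R]_d =>
      l (edist p.1 p.2)).
    apply: (@measurable_nondecreasing_comp _ _ _ l).
    - by move=> u v; exact: radial_nondecreasing.
    - exact: measurable_edist.
    - by move=> p; exact: edist_nneg.
  have profile2_ge0 (p : 'rV[R]_d * 'rV[R]_d) : 0 <= l (edist p.1 p.2).
    by apply: radial_ge0 => //; exact: edist_nneg.
  rewrite (eq_integral (fun p => l (edist p.1 p.2))); last first.
    by move=> p; rewrite inE => -[p1 p2]; rewrite cE.
  rewrite (ge0_integral_conull (measurableX mOmega mOmega) nearest_transport_plan)//.
  transitivity (\int[pushforward rho (fun y => (y, x (nearest x i0 y)))]_p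
      l (edist p.1 p.2)).
    exact: (congr1 (fun f => integral f setT (fun p => l (edist p.1 p.2))) gE).
  rewrite ge0_integral_pushforward// preimage_setT.
  rewrite (ge0_integral_density m_mass _ (fun A _ => rhoE A))//.
  rewrite (ge0_integral_conull mOmega muOmega)//.
    exact: emeasurable_funM.
  by move=> y; rewrite mule_ge0.
rewrite -ge0_integralD//; last 4 first.
- by move=> y _; rewrite mule_ge0.
- by apply: measurable_funTS; exact: emeasurable_funM.
- by move=> y _; exact: entropy_ge0.
- apply: measurable_funTS.
  exact: (measurableT_comp (measurable_entropy hF) m_mass).
apply: ge0_ae_eq_integral => //.
- apply: measurable_funTS; apply: emeasurable_funD; first exact: emeasurable_funM.
  exact: (measurableT_comp (measurable_entropy hF) m_mass).
- exact: measurable_funTS.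
- by move=> y _; rewrite adde_ge0// ?mule_ge0//; exact: entropy_ge0.
apply: filterS ae_single_valued_nearest => y uniq_y _.
by rewrite (cost_densityE hF hl).
Qed.

End transport_to_nearest.

(** These masses suit any sites; [voronoi_cell_mass] relates them to [tessellation_mass]. *)
Lemma exists_cell_mass : exists m : 'I_M -> {nonneg R}, forall k,
  (m k)%:num%:E = \int[mu]_(y in cell k) (mass_density F l (r y))%:E.
Proof.
have [rho rhoE] := exists_density mu m_mass mass_density_bound.
have m0 k : (0 <= fine (rho (cell k)))%R by apply: fine_ge0.
exists (fun k => NngNum (m0 k)) => k /=.
by rewrite -rhoE fineK// fin_num_measure.
Qed.

Lemma exists_nearest_plan (m : 'I_M -> {nonneg R}) :
  (forall k, (m k)%:num%:E =
    \int[mu]_(y in cell k) (mass_density F l (r y))%:E) ->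
  exists2 g, transport_plan Omega g &
    transport_energy F c Omega mu (discrete_measure x m) g = optimal_value.
Proof.
move=> mE; have [rho rhoE] := exists_density mu m_mass mass_density_bound.
have mT : measurable_fun setT (fun y => (y, x (nearest x i0 y))).
  by apply: measurable_fun_pair => //; exact: measurable_nearest_site.
have [g gE] := exists_pushforward rho mT.
exists g; first exact: nearest_transport_plan rhoE _ gE.
exact: nearest_plan_energy rhoE _ gE _ mE.
Qed.

Let m_voronoi i : measurable (voronoi Omega x i).
Proof. exact: measurable_voronoi. Qed.

Lemma voronoi_costE i :
  \int[mu]_(y in voronoi Omega x i) - conjugateE F (- c y (x i)) =
  \int[mu]_(y in voronoi Omega x i) cost_density F l (r y).
Proof.
apply: eq_integral => y; rewrite inE => yV.
rewrite cE//; last by case: yV.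
by rewrite (nearest_voronoi i0 yV).
Qed.

Lemma voronoi_massE i : tessellation_mass F c Omega mu x i =
  \int[mu]_(y in voronoi Omega x i) (mass_density F l (r y))%:E.
Proof.
apply: eq_integral => y; rewrite inE => yV.
rewrite cE//; last by case: yV.
by rewrite (nearest_voronoi i0 yV).
Qed.

Lemma cell_voronoi i : Omega `&` cell i `<=` voronoi Omega x i.
Proof. by move=> y [yO <-]; exact: voronoi_nearest. Qed.

Lemma optimal_value_cells : optimal_value =
  \sum_(k < M) \int[mu]_(y in Omega `&` cell k) cost_density F l (r y).
Proof. exact: ge0_integral_cells. Qed.

Let cell_le_voronoi k :
  \int[mu]_(y in Omega `&` cell k) cost_density F l (r y) <=
  \int[mu]_(y in voronoi Omega x k) cost_density F l (r y).
Proof.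
apply: ge0_subset_integral => //; first exact: measurableI.
  exact: measurable_funTS.
exact: cell_voronoi.
Qed.

Lemma optimal_value_le_tessellation :
  optimal_value <= tessellation_cost F c Omega mu x.
Proof.
rewrite optimal_value_cells; apply: lee_sum => k _.
by rewrite voronoi_costE.
Qed.

(** For distinct sites, a Voronoi cell exceeds its disjoint counterpart only by points on bisectors,
    which are null. *)
Lemma tessellation_cost_injective : injective x ->
  tessellation_cost F c Omega mu x = optimal_value.
Proof.
move=> xinj; rewrite optimal_value_cells; apply: eq_bigr => i _.
rewrite voronoi_costE.
have [N [mN N0 bisN]] : {ae mu, forall y, forall j,
    j != i -> edist y (x i) <> edist y (x j)}.
  apply: filter_forall => j; have [->|ji] := eqVneq j i.
    by apply: filterE => y /negP.
  have xij : x i != x j by apply: contra ji => /eqP/xinj ->.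
  exists [set y | edist y (x i) = edist y (x j)]; split.
  - rewrite [X in measurable X](_ : _ =
      setT `&` (fun y => edist y (x i) - edist y (x j))%R @^-1` [set 0%R]).
      by apply: measurable_funB => //; exact: measurable_edistl.
    rewrite setTI; apply/seteqP; split=> y /= => [->|/eqP]; first by rewrite subrr.
    by rewrite subr_eq0 => /eqP.
  - exact: null_bisector.
  - by move=> y /= h; apply: contrapT => ne; apply: h.
rewrite (ge0_negligible_integral mN)//; last exact: measurable_funTS.
rewrite [RHS](ge0_negligible_integral mN)//; last 2 first.
- exact: measurableI.
- exact: measurable_funTS.
congr (integral mu _ _); apply/seteqP; split=> y [yV yN]; split=> //.
  split; first by case: yV.
  rewrite /cell/=; apply/eqP; apply: contrapT => /negP ni.
  apply: yN; apply: bisN => /= /(_ _ ni); apply.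
  exact: (nearest_voronoi i0 yV).
exact: cell_voronoi.
Qed.

(* When J attains the optimal value the overlaps of the Voronoi cells do not
   contribute to the cost, and then do not contribute to the mass either. *)
Lemma voronoi_cell_mass i :
  tessellation_cost F c Omega mu x <= optimal_value -> optimal_value < +oo ->
  \int[mu]_(y in voronoi Omega x i) (mass_density F l (r y))%:E =
  \int[mu]_(y in cell i) (mass_density F l (r y))%:E.
Proof.
move=> Jopt opty.
pose a k := \int[mu]_(y in voronoi Omega x k) cost_density F l (r y).
pose b k := \int[mu]_(y in Omega `&` cell k) cost_density F l (r y).
have ba k : b k <= a k by exact: cell_le_voronoi.
have a0 k : 0 <= a k by exact: integral_ge0.
have JE : tessellation_cost F c Omega mu x = \sum_(k < M) a k.
  by apply: eq_bigr => k _; rewrite voronoi_costE.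
have a_lty : \sum_(k < M) a k < +oo by rewrite -JE (le_lt_trans Jopt).
(* The finite sum of the [a k] is at most that of the [b k], while [b k <= a k] for each [k]. *)
have ab : a i = b i.
  apply/eqP; rewrite eq_le ba andbT.
  have := Jopt; rewrite JE optimal_value_cells.
  rewrite (bigD1 i)//= [leRHS](bigD1 i)//=.
  have S_fin : \sum_(k < M | k != i) a k \is a fin_num.
    rewrite ge0_fin_numE; last exact: sume_ge0.
    by apply: le_lt_trans a_lty; rewrite [leRHS](bigD1 i)//= leeDr.
  move=> h; rewrite -(leeD2rE _ _ S_fin); apply: (le_trans h).
  by apply: leeD => //; apply: lee_sum.
have a_fin : a i \is a fin_num.
  rewrite ge0_fin_numE//; apply: le_lt_trans a_lty.
  by rewrite [leRHS](bigD1 i)//= leeDl// sume_ge0.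
pose D := voronoi Omega x i `\` (Omega `&` cell i).
have mOc : measurable (Omega `&` cell i) by exact: measurableI.
have mD : measurable D by exact: measurableD.
have VE : voronoi Omega x i = (Omega `&` cell i) `|` D.
  apply/seteqP; split=> y; last by move=> [/cell_voronoi|[]].
  by move=> yV; have [yO|yO] := pselect ((Omega `&` cell i) y); [left|right].
have disj : [disjoint Omega `&` cell i & D].
  by rewrite /D disj_set2E setDE setICA setICr setI0.
have D0 : \int[mu]_(y in D) cost_density F l (r y) = 0.
  apply/eqP; rewrite eq_le integral_ge0// andbT.
  have b_fin : b i \is a fin_num by rewrite -ab.
  rewrite -(leeD2lE _ _ b_fin) adde0 -{2}ab /a VE ge0_integral_setU//.
  exact: measurable_funTS.
(* The nonnegative cost density has zero integral on the overlap [D], so it vanishes almost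
   everywhere there, and the mass vanishes with it. *)
have D_ae : {ae mu, forall y, D y -> mass_density F l (r y) = 0%R}.
  have : ae_eq mu D (fun y => cost_density F l (r y)) (cst 0).
    apply/(ae_eq_integral_abs mu mD); first exact: measurable_funTS.
    by under eq_integral do rewrite gee0_abs//.
  apply: filterS2 ae_nearest_dist_gt0 => y rgt0 /[apply] /= Ky.
  exact: (mass_density_eq0 hF hl).
have m_mass_e : measurable_fun setT (fun y => (mass_density F l (r y))%:E).
  exact/measurable_EFinP.
have mass_ge0 y : 0 <= (mass_density F l (r y))%:E.
  by rewrite lee_fin; have /andP[] := mass_density_bound y.
rewrite VE ge0_integral_setU//; last exact: measurable_funTS.
rewrite [X in _ + X](_ : _ = 0) ?adde0; last first.
  rewrite (@ge0_ae_eq_integral _ _ _ _ _ _ (cst 0))//.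
  - exact: integral0.
  - exact: measurable_funTS.
  - by apply: filterS D_ae => y /[apply] ->.
(* [cell i] may leave [Omega], but [mu] does not charge the complement. *)
rewrite [RHS](ge0_negligible_integral (measurableC mOmega))//.
  by rewrite setDE setCK setIC.
exact: measurable_funTS.
Qed.

End tessellation.

(** * Distinct sites *)

Section distinct_sites.
Variables (R : realType) (d : nat).
Hypothesis d_gt0 : (0 < d)%N.

(** Diagonal shifts of a point of [U] by [e / n.+2%:R < e] are pairwise distinct and stay in [U]; a
    finite list cannot contain them all. *)
Lemma open_fresh_point (U : set 'rV[R]_d) (s : seq 'rV[R]_d) :
  open U -> U !=set0 -> exists2 y, U y & y \notin s.
Proof.
move=> oU [u Uu]; have /nbhs_ballP[e /= e0 eU] := open_nbhs_nbhs (conj oU Uu).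
pose p (n : nat) : 'rV[R]_d := u + const_mx (e / n.+2%:R).
have pU n : U (p n).
  apply: eU; split=> [//|i j]; rewrite !mxE /ball/= opprD addNKr normrN.
  rewrite ger0_norm ?divr_ge0 ?(ltW e0)// ltr_pdivrMr ?ltr0n//.
  by rewrite ltr_pMr// ltr1n.
have pinj : injective p.
  move=> m n /addrI/matrixP/(_ 0 (Ordinal d_gt0)); rewrite !mxE => /mulfI.
  by move=> /(_ (lt0r_neq0 e0))/invr_inj/eqP; rewrite eqr_nat => /eqP[].
apply: contrapT => none.
have ps : {subset map p (iota 0 (size s).+1) <= s}.
  move=> _ /mapP[n _ ->]; apply: contrapT => /negP pn.
  by apply: none; exists (p n).
have := uniq_leq_size _ ps; rewrite (map_inj_uniq pinj) iota_uniq => /(_ isT).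
by rewrite size_map size_iota ltnn.
Qed.

(** Duplicates are removed and the list is filled up to [M] sites with fresh points of [U]. *)
Lemma exists_injective_sites (M : nat) (U Omega : set 'rV[R]_d)
    (x : 'I_M -> 'rV[R]_d) : open U -> U !=set0 -> U `<=` Omega ->
  in_domain Omega x ->
  exists x' : 'I_M -> 'rV[R]_d,
    [/\ injective x', in_domain Omega x' & forall i, exists j, x' j = x i].
Proof.
move=> oU U0 UO xO; pose s := undup (codom x).
have ext n : exists t : seq 'rV[R]_d, [/\ uniq t, size t = (size s + n)%N,
    forall y, y \in t -> Omega y & {subset s <= t}].
  elim: n => [|n [t [ut st tO sub]]].
    exists s; split; rewrite ?undup_uniq ?addn0// => y.
    by rewrite mem_undup => /codomP[i ->].
  have [y Uy yt] := open_fresh_point t oU U0.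
  exists (y :: t); split=> [|||z zs].
  - by rewrite /= yt.
  - by rewrite /= st addnS.
  - by move=> z; rewrite inE => /predU1P[->|/tO//]; exact: UO.
  - by rewrite inE sub ?orbT.
have sM : (size s <= M)%N by rewrite (leq_trans (size_undup _))// size_codom card_ord.
have [t [ut st tO sub]] := ext (M - size s)%N; rewrite subnKC// in st.
exists (fun j => nth 0 t j); split.
- move=> i j /eqP; rewrite nth_uniq ?st// => /eqP; exact: val_inj.
- by move=> i; apply: tO; rewrite mem_nth// st.
- move=> i; have : x i \in t by apply: sub; rewrite mem_undup codom_f.
  move=> xt; have it : (index (x i) t < M)%N by rewrite -st index_mem.
  by exists (Ordinal it); rewrite nth_index.
Qed.

End distinct_sites.

(** Additional sites can only shorten the distance to the nearest one, and [cost_density] is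
    nondecreasing. *)
Lemma optimal_value_antitone (R : realType) (d M : nat) (Omega : set 'rV[R]_d)
    (l F : R -> \bar R) (mu : {finite_measure set 'rV[R]_d -> \bar R})
    (x x' : 'I_M -> 'rV[R]_d) (i0 : 'I_M) :
  measurable Omega -> is_radial_profile l -> is_entropy F ->
  (forall i, exists j, x' j = x i) ->
  (optimal_value Omega l F mu x' i0 <= optimal_value Omega l F mu x i0)%E.
Proof.
move=> mO hl hF xx'; apply: ge0_le_integral => //.
- by move=> y _; apply: cost_density_ge0 => //; exact: nearest_dist_ge0.
- by apply: measurable_funTS; exact: measurable_nearest_cost.
- by apply: measurable_funTS; exact: measurable_nearest_cost.
move=> y _; apply: cost_density_nondecreasing => //; rewrite nearest_dist_ge0/=.
have [j jE] := xx' (nearest x i0 y).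
by apply: (le_trans (nearest_dist_le x' i0 y j)); rewrite jE.
Qed.

(** * Equivalence of the two minimization problems *)

Theorem theorem4p2 (R : realType) (d : nat) (hd : (0 < d)%N)
    (U Omega : set 'rV[R]_d) (hU : open U) (hOmega : Omega = closure U)
    (c : 'rV[R]_d -> 'rV[R]_d -> \bar R)
    (hc : is_cost Omega c) (hrad : is_radial Omega c)
    (F : R -> \bar R) (hF : is_entropy F) (hF1 : F 1 = 0%E)
    (mu : {finite_measure set 'rV[R]_d -> \bar R})
    (hmu : mu (~` Omega) = 0%E) (hmuL : mu `<< @rV_lebesgue R d)
    (M : nat) (hM : (0 < M)%N) :
  let Q := @quantizer R d M Omega in
  let T := @in_domain R d M Omega in
  let W := @quantization_cost R d M F c Omega mu in
  let J := @tessellation_cost R d M F c Omega mu in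
  [/\ ereal_inf [set W q | q in Q] = ereal_inf [set J x | x in T],
      (exists q, is_minimizer Q W q) <-> (exists x, is_minimizer T J x),
      forall x, T x -> forall i,
        {ae mu, forall y, Omega y ->
          exists! s, subdiff_conjugateE F (- c y (x i))%E s} &
      forall x, is_minimizer T J x -> (J x < +oo)%E ->
        exists m : 'I_M -> {nonneg R},
          [/\ forall i,
                ((m i)%:num)%:E = tessellation_mass F c Omega mu x i,
              is_minimizer Q W (x, m),
              exists g, optimal_plan F c Omega mu (discrete_measure x m) g &
              forall g, optimal_plan F c Omega mu (discrete_measure x m) g ->
                g (~` (\bigcup_(i in [set: 'I_M])
                         (voronoi Omega x i `*` [set x i]))) = 0%E]].
Proof.
move=> Q T W J.
have mO : measurable Omega.
  by apply: closed_measurable_rV; rewrite hOmega; exact: closed_closure.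
have [l hl cE] := hrad.
pose i0 := Ordinal hM.
pose opt x := optimal_value Omega l F mu x i0.
have opt_le_W q : Q q -> (opt q.1 <= W q)%E.
  move=> Qq; apply/ereal_infP => _ [g gplan <-].
  exact: optimal_value_le_energy.
have W_le_opt x m : T x -> (forall k, ((m k)%:num)%:E =
    \int[mu]_(y in cell x i0 k) (mass_density F l (nearest_dist x i0 y))%:E)%E ->
    (W (x, m) <= opt x)%E.
  move=> Tx mE.
  have [g gplan gE] := exists_nearest_plan hd mO hl hF hF1 cE hmu hmuL Tx mE.
  by rewrite /opt -gE; apply: ereal_inf_lbound; exists g.
have opt_le_J x : T x -> (opt x <= J x)%E.
  exact: optimal_value_le_tessellation.
(* Repeated sites are replaced by fresh points of [U], which is nonempty because its closure
   contains a site. *)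
have J_le_opt x : T x -> exists2 x', T x' & (J x' <= opt x)%E.
  move=> Tx; have U0 : U !=set0.
    have := Tx i0; rewrite hOmega => /(_ setT filterT) [u [Uu _]].
    by exists u.
  have UO : U `<=` Omega by rewrite hOmega; exact: subset_closure.
  have [x' [x'inj Tx' xx']] := exists_injective_sites hd hU U0 UO Tx.
  exists x' => //.
  rewrite /J (tessellation_cost_injective mO hl hF cE hmuL i0 Tx' x'inj).
  exact: optimal_value_antitone.
(* The chain is [W (x, m) <= opt x <= J x <= J x' <= opt q.1 <= W q], with [x'] the distinct
   replacement of the sites of [q]. *)
have J_min_W x m : is_minimizer T J x -> (forall k, ((m k)%:num)%:E =
    \int[mu]_(y in cell x i0 k) (mass_density F l (nearest_dist x i0 y))%:E)%E ->
    is_minimizer Q W (x, m).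
  move=> [Tx Jmin] mE; split=> // q Qq.
  have [x' Tx' x'q] := J_le_opt q.1 Qq.
  apply: (le_trans (W_le_opt _ _ Tx mE)); apply: (le_trans (opt_le_J _ Tx)).
  apply: (le_trans (Jmin _ Tx')); apply: (le_trans x'q); exact: opt_le_W.
split.
- apply/eqP; rewrite eq_le; apply/andP; split; apply/ereal_infP.
    move=> _ [x Tx <-]; have [m mE] := exists_cell_mass mu hl hF x i0.
    apply: le_trans (opt_le_J _ Tx); apply: le_trans (W_le_opt _ _ Tx mE).
    by apply: ereal_inf_lbound; exists (x, m).
  move=> _ [q Qq <-]; have [x' Tx' x'q] := J_le_opt q.1 Qq.
  apply: (le_trans _ (opt_le_W _ Qq)); apply: (le_trans _ x'q).
  by apply: ereal_inf_lbound; exists x'.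
- split=> [[q [Qq qmin]]|[x xmin]].
    (* The sites of a minimizer of [W] may coincide, so their distinct replacement is taken as the
       minimizer of [J]. *)
    have [x' Tx' x'q] := J_le_opt q.1 Qq; exists x'; split=> // x Tx.
    have [m mE] := exists_cell_mass mu hl hF x i0.
    apply: (le_trans x'q); apply: (le_trans (opt_le_W _ Qq)).
    apply: (le_trans (qmin (x, m) Tx)); apply: (le_trans (W_le_opt _ _ Tx mE)).
    exact: opt_le_J.
  have [m mE] := exists_cell_mass mu hl hF x i0.
  by exists (x, m); exact: J_min_W.
- move=> x Tx i; have := ae_single_valued hd hl hF hmuL (x i).
  by apply: filterS => y uniq_y Oy; rewrite cE.
move=> x [Tx Jmin] Jfin; have [m mE] := exists_cell_mass mu hl hF x i0.
(* A minimizer of [J] does no worse than its distinct replacement; this is the hypothesis of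
   [voronoi_cell_mass]. *)
have Jopt : (J x <= opt x)%E.
  by have [x' Tx' x'x] := J_le_opt x Tx; apply: le_trans x'x; exact: Jmin.
have opt_fin : (opt x < +oo)%E by apply: le_lt_trans Jfin; exact: opt_le_J.
have [g0 g0plan g0E] := exists_nearest_plan hd mO hl hF hF1 cE hmu hmuL Tx mE.
exists m; split.
- move=> i; rewrite mE (voronoi_massE F mu cE i0 Tx).
  exact/esym/(voronoi_cell_mass hd mO hl hF cE hmu hmuL Tx i Jopt opt_fin).
- exact: J_min_W.
- exists g0; split=> // g gplan; rewrite g0E.
  exact: optimal_value_le_energy.
- move=> g [gplan gmin].
  apply: (optimal_plan_voronoi mO hl hF cE hmu Tx gplan _ opt_fin).
  by rewrite -/(opt x) /opt -g0E; exact: gmin.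
Qed.
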